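(* Let $S_*>0$ be known and let $\psi:\mathbb{R}\to(0,\infty)$ be positive, continuously differentiable at the point $0$, with $\psi(0)=1$ and $\dot\psi(0)>0$. Let $\varepsilon\in(0,1)$ and put $a_\varepsilon=\frac{1}{2}\bigl(1-z_{\frac{1-\varepsilon}{2}}^2\bigr)$. Then the score function test $$\phi_T^*(X^T)=\mathbf{1}_{\{\Delta_T(X^T)>a_\varepsilon\}}$$ belongs to the class $\mathcal{K}_\varepsilon$, that is, $\lim_{T\to\infty}\mathbf{E}_0\,\phi_T^*(X^T)=\varepsilon$, and for any $u_*>0$ its power function satisfies, as $T\to\infty$, $$\beta_T(u_*,\phi_T^* )=\mathbf{E}_{u_*}\phi_T^*(X^T)\longrightarrow \beta^*(u_* )=\mathbf{P}\Bigl\{|\zeta|\le h(u_* )\,z_{\frac{1-\varepsilon}{2}}\Bigr\},$$ where $\zeta\sim\mathcal{N}(0,1)$ and $h(u)=\sqrt{\dfrac{2u}{1-e^{-2u}}}$.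
   Context: Model. One observes a trajectory $X^T=\{X_t,\ 0\le t\le T\}$ of a counting process ($X_t$ is the number of events in $[0,t]$, $X_0=0$). For $u\ge 0$, $\mathbf{P}_u$ (with expectation $\mathbf{E}_u$; the dependence on $T$ is suppressed) denotes the law under which $X$ has intensity function (with respect to its natural filtration) $$S(t,X_t)=S_*\,\psi\bigl(\vartheta_T\,[S_*t-X_t]\bigr),\qquad \vartheta_T=\frac{u}{S_*\,\dot\psi(0)\,T},\qquad 0\le t\le T.$$ Thus under $\mathbf{P}_0$ (hypothesis $u=0$) $X$ is a Poisson process of constant intensity $S_*$; the alternative is $u>0$. ''Continuously differentiable at $0$'' means that $\psi$ is differentiable in a neighbourhood of $0$ with derivative $\dot\psi$ continuous at $0$. It is taken for granted that the laws $\mathbf{P}_u$ are well defined and that the likelihood ratio $d\mathbf{P}_u/d\mathbf{P}_0$ on $[0,T]$ is $L\bigl(\frac{u}{\gamma T},X^T\bigr)$, where $\gamma=S_*\dot\psi(0)$ and $$L(\vartheta,X^T)=\exp\Bigl\{\int_0^T\ln\psi\bigl(\vartheta(S_*t-X_{t-})\bigr)\,[dX_t-S_*dt]-\int_0^T\bigl[\psi\bigl(\vartheta(S_*t-X_t)\bigr)-1-\ln\psi\bigl(\vartheta(S_*t-X_t)\bigr)\bigr]S_*\,dt\Bigr\},$$ with $X_{t-}$ the left limit of $X$ at $t$. Statistic: $$\Delta_T(X^T)=\frac{1}{S_*T}\int_0^T(S_*t-X_{t-})\,[dX_t-S_*dt]=\frac{X_T-(X_T-S_*T)^2}{2S_*T}.$$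 For $a\in(0,1)$, $z_a$ is the $(1-a)$-quantile of the standard Gaussian law: $\mathbf{P}(\zeta>z_a)=a$ for $\zeta\sim\mathcal{N}(0,1)$. $\mathcal{K}_\varepsilon$ is the class of test functions $\phi_T(X^T)$ ($\phi_T(X^T)$ being the probability of accepting the alternative) with $\lim_{T\to\infty}\mathbf{E}_0\phi_T(X^T)=\varepsilon$. *)

(* Defs.v *)
From HB Require Import structures.
From mathcomp Require Import all_boot all_order all_algebra.
From mathcomp Require Import all_classical all_reals all_analysis.

Set Implicit Arguments.
Unset Strict Implicit.
Unset Printing Implicit Defensive.

Import Order.TTheory GRing.Theory Num.Theory.
Import numFieldNormedType.Exports.

Local Open Scope classical_set_scope.
Local Open Scope ring_scope.

Section CountingPaths.
Context {R : realType}.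
Implicit Types (x : R -> nat) (c : R -> R).

(** Only the values [x t] with [0 <= t] matter.  The last clause says that
    events occur one at a time. *)
Definition counting_path x : Prop :=
  [/\ x 0 = 0%N,
      forall s t : R, 0 <= s -> s <= t -> (x s <= x t)%N,
      forall t : R, 0 <= t -> \forall s \near t^'+, x s = x t
    & forall t : R, 0 < t -> \forall s \near t^'-, (x t <= (x s).+1)%N].

(** The left limit [x_{t-}], meaningful for [0 < t]. *)
Definition left_value x (t : R) : R := lim (((x s)%:R : R) @[s --> t^'-]).

(** Time of the [k]-th event, for [0 < k] and provided it occurs. *)
Definition event_time x (k : nat) : R := inf [set t | 0 <= t /\ (k <= x t)%N].

(** The Stieltjes integral of [c t] against [d x_t] over [0, T]: the measure
    [d x] has a unit mass at each event time. *)
Definition path_integral x (T : R) c : R :=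
  \sum_(1 <= k < (x T).+1) c (event_time x k).

(** The integral of [c t] against [d x_t - S dt] over [0, T]. *)
Definition centred_integral (S : R) x (T : R) c : R :=
  path_integral x T c - S * Rintegral lebesgue_measure `[0, T] c.

Definition score_statistic (S : R) x (T : R) : R :=
  (S * T)^-1 * centred_integral S x T (fun t => S * t - left_value x t).

End CountingPaths.

Section Intensity.
Context {R : realType} {d : measure_display} {Omega : measurableType d}.
Implicit Types (X : R -> Omega -> nat) (F : R -> set (set Omega)).

Definition counting_process X : Prop :=
  (forall t : R, 0 <= t -> measurable_fun setT (X t)) /\
  (forall w, counting_path (X ^~ w)).

Definition natural_filtration X (t : R) : set (set Omega) :=
  <<s [set A | exists (s : R) (B : set nat),
         [/\ 0 <= s, s <= t & A = X s @^-1` B]] >>.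

Definition measurable_wrt (U : Type) (D : set U) (G : set (set U))
    (f : U -> R) : Prop :=
  forall B, measurable B -> G (D `&` f @^-1` B).

Definition predictable_sigma F (T : R) : set (set (R * Omega)) :=
  <<s `[0, T] `*` setT,
      [set E | (exists (s t : R) A, [/\ 0 <= s, s <= t, t <= T, F s A &
                  E = `]s, t] `*` A]) \/
               (exists2 A, F 0 A & E = [set 0] `*` A)] >>.

Definition predictable F (T : R) (C : R -> Omega -> R) : Prop :=
  measurable_wrt (`[0, T] `*` setT) (predictable_sigma F T)
    (fun p : R * Omega => C p.1 p.2).

Definition progressive F (T : R) (lam : R -> Omega -> R) : Prop :=
  forall t : R, 0 <= t -> t <= T ->
    measurable_wrt (`[0, t] `*` setT)
      <<s `[0, t] `*` setT,
          [set E | exists (I : set R) (A : set Omega),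
             [/\ measurable I, F t A & E = (`[0, t] `&` I) `*` A]] >>
      (fun p : R * Omega => lam p.1 p.2).

(** [lam] is the intensity of [X] on [0, T] under [P], with respect to the
    natural filtration of [X]: the definition of P. Bremaud, Point Processes
    and Queues (1981), II.D7. *)
Definition has_intensity (P : probability Omega R) X (T : R)
    (lam : R -> Omega -> R) : Prop :=
  [/\ forall (t : R) w, 0 <= t -> t <= T -> 0 <= lam t w,
      progressive (natural_filtration X) T lam,
      {ae P, forall w,
        (\int[lebesgue_measure]_(t in `[0%R, T]) (lam t w)%:E < +oo)%E}
    & forall C : R -> Omega -> R,
        (forall t w, 0 <= C t w) ->
        predictable (natural_filtration X) T C ->
        (\int[P]_w (path_integral (X ^~ w) T (C ^~ w))%:E =
         \int[P]_w \int[lebesgue_measure]_(t in `[0%R, T])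
           (C t w * lam t w)%:E)%E].

End Intensity.

Section Tests.
Context {R : realType} {d : measure_display} {Omega : measurableType d}.

(** [phi T] is a function of the trajectory on [0, T]. *)
Definition test_function (X : R -> Omega -> nat) (phi : R -> Omega -> R) :=
  forall T : R, 0 < T ->
    (forall w, 0 <= phi T w <= 1) /\
    measurable_wrt setT (natural_filtration X T) (phi T).

(** The class of tests of asymptotic size [eps]; [P T u] is the law on [0, T]
    with parameter [u], so [P T 0] is the law under the hypothesis. *)
Definition asymptotic_size_class (X : R -> Omega -> nat)
    (P : R -> R -> probability Omega R) (eps : R) (phi : R -> Omega -> R) :=
  test_function X phi /\
  ('E_(P T 0%R)[phi T])%E @[T --> +oo] --> eps%:E.

End Tests.

Section Model.
Context {R : realType}.

(** The [(1 - a)]-quantile of N(0, 1), i.e., the [z] such that the upper tail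
    beyond [z] has probability [a]. *)
Definition gauss_quantile (a : R) : R :=
  inf [set z : R | (normal_prob 0 1 `]z, +oo[ <= a%:E)%E].

Definition theta (S : R) (psi : R -> R) (T u : R) : R :=
  u / (S * derive1 psi 0 * T).

Definition intensity (S : R) (psi : R -> R) (T u t : R) (n : nat) : R :=
  S * psi (theta S psi T u * (S * t - n%:R)).

Definition C1_at0 (psi : R -> R) : Prop :=
  (\forall x \near 0, derivable psi x 1) /\ {for 0, continuous (derive1 psi)}.

Definition threshold (eps : R) : R :=
  (1 - gauss_quantile ((1 - eps) / 2) ^+ 2) / 2.

Definition hfun (u : R) : R := Num.sqrt (2 * u / (1 - expR (- (2 * u)))).

Definition score_test (d : measure_display) (Omega : measurableType d)
    (X : R -> Omega -> nat) (S eps T : R) : Omega -> R :=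
  \1_[set w | threshold eps < score_statistic S (X ^~ w) T].

End Model.

(* Main.v *)
Require Import Defs.
From HB Require Import structures.
From mathcomp Require Import all_boot all_order all_algebra.
From mathcomp Require Import all_classical all_reals all_analysis.
From mathcomp Require Import measurable_realfun ring lra.

Import Order.TTheory GRing.Theory Num.Theory.
Import numFieldNormedType.Exports.
Local Open Scope classical_set_scope.
Local Open Scope ring_scope.

(** Put [N = S T] and [Y = (X_T - N) / sqrt N].  The score statistic telescopes
    to [(X_T - (X_T - N)^2) / (2 N) = (1 + Y / sqrt N - Y^2) / 2]
    ([score_statisticE]), so the test accepts the alternative exactly when
    [Y^2 - Y / sqrt N < z^2] ([acceptedE]), an interval which tends to
    [(- z, z)].  Everything thus reduces to the weak limit of [Y]: the value at
    time 1 of the Ornstein-Uhlenbeck process [dY = - u Y dt + dW], [Y 0 = 0],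
    a centred Gaussian variable of variance [(1 - e^(- 2 u)) / (2 u)], or 1 when
    [u = 0] ([power_limit]).

    The limit theorem is proved with the backward equation.  The backward
    Ornstein-Uhlenbeck equation [v_s = u y v_y - v_yy / 2] with terminal value
    [Phi ((y - c) / sqrt b)] has the explicit solution
    [v (s, y) = Phi ((m s * y - c) / sqrt (q s))], where
    [m' = u m], [q' = - m^2], [m 1 = 1] and [q 1 = b].  Along the rescaled
    counting process, whose normalized intensity is [psi (- (u / psi'(0)) x) =
    1 - u x + o(x)] at [x = (X_t - S t) / N], the leading terms of the drift of
    [v] cancel, and what remains, integrated over [[0, T]], is small when [x] and
    [1 / sqrt N] are ([generator_ge]).

    Away from 0 only the sign of [psi] is known, so [v] is multiplied by a cutoff
    [chi (x)], which vanishes outside a small interval.  Since [chi] decreases in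
    [|x|] while the intensity pushes [x] back to 0, the extra drift
    [v chi' (psi - 1)] is nonnegative: the cutoff preserves lower bounds on
    expectations ([score_liminf]).  Lower bounds for [v] and for [1 - v] (the
    sign of [m] and [c] exchanges the two) give the limit.

    The passage from the intensity to expectations ([dynkin_ge]) is pathwise.
    A function [f (t, X_t)] changes by its time derivative plus its jumps
    ([path_formula]), and the jump from [n] to [n + 1] is charged by the
    predictable integrand [c (t) 1 (X_(t-) = n)], whose integral against [X] is
    [c] at the time of event [n + 1]: the definition of the intensity replaces
    it, in mean, by the integral of [c (t) lambda (t, n)] over the time spent at [n]
    ([crossing_balance]).  The cutoff leaves finitely many [n].

    Finally the smoothed indicators [Phi ((y - c) / sqrt b)], with [b] tending
    to 0, give the distribution function of [Y] ([tail_liminf]). *)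

Set Implicit Arguments.
Unset Strict Implicit.
Unset Printing Implicit Defensive.

(** * Scalar derivatives and Taylor bounds *)

(** Fixing the scalar domain and codomain lets rules be chained on lambda-terms,
    which unification does not see as pointwise sums and products. *)
Definition has_derivative {R : realType} (f : R -> R) (x a : R) : Prop :=
  is_derive x (1 : R) f a.

Section RealCalculus.
Context {R : realType}.
Implicit Types (f g df : R -> R) (x k C : R).

Lemma has_derivative_ext f g x (df : R) :
  f =1 g -> has_derivative f x df -> has_derivative g x df.
Proof. by move=> /funext ->. Qed.

Lemma has_derivative_eq f x (a b : R) :
  has_derivative f x a -> a = b -> has_derivative f x b.
Proof. by move=> ? <-. Qed.

Lemma has_derivative_cst (a : R) x : has_derivative (fun _ => a) x 0.
Proof. exact: is_derive_cst. Qed.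

Lemma has_derivative_id x : has_derivative (fun t => t) x 1.
Proof. exact: is_derive_id. Qed.

Lemma has_derivative_sub f g x (a b : R) :
  has_derivative f x a -> has_derivative g x b ->
  has_derivative (fun t => f t - g t) x (a - b).
Proof. exact: is_deriveB. Qed.

Lemma has_derivative_add f g x (a b : R) :
  has_derivative f x a -> has_derivative g x b ->
  has_derivative (fun t => f t + g t) x (a + b).
Proof. exact: is_deriveD. Qed.

Lemma has_derivative_mul f g x (a b : R) :
  has_derivative f x a -> has_derivative g x b ->
  has_derivative (fun t => f t * g t) x (a * g x + f x * b).
Proof.
move=> fa gb; have h := is_deriveM fa gb; apply: (is_derive_eq h).
by rewrite /GRing.scale /= addrC (mulrC (g x)).
Qed.

Lemma has_derivative_affine (a b : R) x : has_derivative (fun t => a * t + b) x a.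
Proof.
have h := has_derivative_add (has_derivative_mul
   (has_derivative_cst a x) (has_derivative_id x)) (has_derivative_cst b x).
by apply: (has_derivative_eq h); rewrite mul0r add0r mulr1 addr0.
Qed.

Lemma has_derivative_comp f g x (a b : R) :
  has_derivative f (g x) a -> has_derivative g x b ->
  has_derivative (fun t => f (g t)) x (a * b).
Proof. exact: is_derive1_comp. Qed.

Lemma has_derivative_continuous f x (a : R) :
  has_derivative f x a -> {for x, continuous f}.
Proof.
by move=> [+ _]; rewrite derivable1_diffP => /differentiable_continuous.
Qed.

(** A quadratic remainder identifies the derivative; this handles the points
    where a function defined by cases changes its expression. *)
Lemma has_derivative_of_quadratic f x (a : R) K :
  (forall e, `|f (x + e) - f x - a * e| <= K * e ^+ 2) -> has_derivative f x a.
Proof.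
move=> fK.
have K0 : 0 <= K by have := le_trans (normr_ge0 _) (fK 1); rewrite expr1n mulr1.
suff l : h^-1 *: (f (h *: (1 : R) + x) - f x) @[h --> (0 : R)^'] --> a.
  apply: DeriveDef; last exact: cvg_lim l.
  by apply/cvg_ex; exists a.
apply/cvgrPdist_le => /= eps e0; near=> h.
have h0 : h != 0 by near: h; exact: nbhs_dnbhs_neq.
have hE : `|h| <= eps / (K + 1).
  near: h; apply: dnbhs0_le; rewrite divr_gt0//; lra.
rewrite /GRing.scale/= mulr1 -[h + x]addrC.
have hp : 0 < `|h| by rewrite normr_gt0.
rewrite -(ler_pM2r hp) -normrM mulrBl mulrAC mulVf// mul1r distrC.
apply: le_trans (fK h) _.
rewrite -real_normK ?num_real// expr2 mulrA ler_wpM2r//.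
rewrite (le_trans (ler_wpM2l K0 hE))// mulrCA ler_piMr ?(ltW e0)//.
rewrite ler_pdivrMr; lra.
Unshelve. all: by end_near.
Qed.

(** Bounding the derivative on the whole interval [|x| <= |k|] makes the
    estimate apply to itself, so three uses give Taylor's bound below. *)
Lemma le_norm_of_derive_le f df k C :
  f 0 = 0 -> (forall x, `|x| <= `|k| -> has_derivative f x (df x)) ->
  (forall x, `|x| <= `|k| -> `|df x| <= C) -> `|f k| <= C * `|k|.
Proof.
move=> f0 fd fC.
have wc (a b : R) : - `|k| <= a -> b <= `|k| -> {within `[a, b], continuous f}.
  move=> ak bk; apply: derivable_within_continuous => z.
  rewrite in_itv/= => /andP[az zb]; have zk : `|z| <= `|k|.
    by rewrite ler_norml (le_trans ak az) (le_trans zb bk).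
  by case: (fd z zk).
have fI : forall a b z : R, - `|k| <= a -> b <= `|k| -> z \in `]a, b[%R ->
    has_derivative f z (df z).
  move=> a b z ak bk; rewrite in_itv/= => /andP[az zb]; apply: fd.
  by rewrite ler_norml (le_trans ak (ltW az)) (le_trans (ltW zb) bk).
have [k0|k0] := leP 0 k.
- have kk : `|k| = k by rewrite ger0_norm.
  have [|||c] := @MVT_segment R f df 0 k => //.
  + by move=> z; apply: fI; rewrite ?oppr_le0 ?kk.
  + by apply: wc; rewrite ?oppr_le0 ?kk.
  rewrite in_itv/= f0 !subr0 => /andP[c0 ck] ->.
  rewrite normrM ler_wpM2r// fC// ger0_norm// ?kk//.
- have kk : `|k| = - k by rewrite ltr0_norm.
  have [|||c] := @MVT_segment R f df k 0 => //.
  + by rewrite ltW.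
  + by move=> z; apply: fI; rewrite ?normr_ge0 ?kk ?opprK.
  + by apply: wc; rewrite ?normr_ge0 ?kk ?opprK.
  rewrite in_itv/= f0 !sub0r => /andP[c0 ck] /eqP; rewrite eqr_oppLR => /eqP ->.
  rewrite normrN normrM normrN ler_wpM2r// fC// !ler0_norm ?lerN2// ltW//.
Qed.

Lemma taylor2_le f (f1 f2 f3 : R -> R) C x k :
  (forall z, has_derivative f z (f1 z)) ->
  (forall z, has_derivative f1 z (f2 z)) ->
  (forall z, has_derivative f2 z (f3 z)) ->
  (forall z, `|f3 z| <= C) ->
  `|f (x + k) - f x - f1 x * k - f2 x * k ^+ 2 / 2| <= C * `|k| ^+ 3.
Proof.
move=> d1 d2 d3 hC; have C0 : 0 <= C by rewrite (le_trans _ (hC 0)).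
have sh : forall (g dg : R -> R) z, (forall z, has_derivative g z (dg z)) ->
    has_derivative (fun t => g (x + t)) z (dg (x + z)).
  move=> g dg z dgd; have h := has_derivative_comp (dgd _) (has_derivative_affine 1 x z).
  apply: (has_derivative_ext _ (has_derivative_eq h _)) => [t|].
    by rewrite mul1r addrC.
  by rewrite mulr1 mul1r addrC.
have h2 z : `|f2 (x + z) - f2 x| <= C * `|z|.
  apply: (@le_norm_of_derive_le (fun t => f2 (x + t) - f2 x) (fun t => f3 (x + t))).
  - by rewrite addr0 subrr.
  - move=> t _; have h := has_derivative_sub (sh _ _ t d3) (has_derivative_cst (f2 x) t).
    by apply: (has_derivative_eq h); rewrite subr0.
  - by move=> t _; exact: hC.
have h1 z : `|f1 (x + z) - f1 x - f2 x * z| <= C * `|z| ^+ 2.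
  rewrite expr2 mulrA.
  apply: (@le_norm_of_derive_le (fun t => f1 (x + t) - f1 x - f2 x * t)
     (fun t => f2 (x + t) - f2 x)).
  - by rewrite addr0 mulr0 !subrr.
  - move=> t _; have h := has_derivative_sub (sh _ _ t d2) (has_derivative_affine (f2 x) (f1 x) t).
    by apply: (has_derivative_ext _ h) => s; lra.
  - by move=> t tz; rewrite (le_trans (h2 t))// ler_wpM2l.
have -> : C * `|k| ^+ 3 = C * `|k| ^+ 2 * `|k| by rewrite exprSr mulrA.
apply: (@le_norm_of_derive_le (fun t => f (x + t) - f x - f1 x * t - f2 x * t ^+ 2 / 2)
     (fun t => f1 (x + t) - f1 x - f2 x * t)).
- by rewrite addr0 expr0n /= !mulr0 mul0r !subrr.
- move=> t _.
  have h := has_derivative_sub (sh _ _ t d1) (has_derivative_affine (f1 x) (f x) t).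
  have h' := has_derivative_mul (has_derivative_id t) (has_derivative_affine (f2 x / 2) 0 t).
  have h'' := has_derivative_sub h h'.
  apply: (has_derivative_ext _ (has_derivative_eq h'' _)) => [s|]; lra.
- move=> t tk; rewrite (le_trans (h1 t))// ler_wpM2l// lerXn2r ?nnegrE//.
Qed.

End RealCalculus.

(** * The Gaussian distribution function *)

Section GaussianDistributionFunction.
Context {R : realType}.
Implicit Types x y k : R.

Definition gauss_pdf : R -> R := normal_pdf 0 1.

Definition gauss_cdf x : R := fine (normal_prob 0 1 `]-oo, x]).

Lemma gauss_cdfE x : normal_prob 0 1 `]-oo, x] = (gauss_cdf x)%:E.
Proof. by rewrite /gauss_cdf fineK// fin_num_measure. Qed.

Lemma gauss_cdf_ge0 x : 0 <= gauss_cdf x.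
Proof. by rewrite /gauss_cdf fine_ge0. Qed.

Lemma gauss_cdf_le1 x : gauss_cdf x <= 1.
Proof. by rewrite -lee_fin -gauss_cdfE probability_le1. Qed.

Lemma le_gauss_cdf x y : x <= y -> gauss_cdf x <= gauss_cdf y.
Proof.
move=> xy; rewrite -lee_fin -!gauss_cdfE le_measure ?inE//.
by apply: subset_itvl; rewrite bnd_simp.
Qed.

Lemma has_derivative_gauss_cdf x : has_derivative gauss_cdf x (gauss_pdf x).
Proof.
have c : {for x, continuous gauss_pdf}.
  by apply: continuous_normal_pdf; rewrite oner_eq0.
have i : lebesgue_measure.-integrable `]-oo, (x + 1)] (EFin \o gauss_pdf).
  apply: (integrableS _ _ (@subsetT _ _)) => //.
  exact: integrable_normal_pdf.
have x1 : x < x + 1 by rewrite ltrDl.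
have [|dF] := @continuous_FTC1 R gauss_pdf -oo%O x (x + 1) x1 i _ c.
  by rewrite ltNyr.
by rewrite derive1E => F'; split.
Qed.

Lemma gauss_pdfE x : gauss_pdf x = normal_peak 1 * expR (- (x ^+ 2 / 2)).
Proof.
by rewrite /gauss_pdf normal_pdfE ?oner_eq0// /normal_fun subr0 expr1n mulNr.
Qed.

Lemma gauss_pdf_gt0 x : 0 < gauss_pdf x.
Proof. by rewrite gauss_pdfE mulr_gt0 ?expR_gt0// normal_peak_gt0// oner_eq0. Qed.

(** [e^(x^2 / 2)] dominates [1 + x^2 / 2], and the normalizing constant is at
    most 1.  The bounds on the density and its derivatives follow from this. *)
Lemma gauss_pdf_bound x : (1 + x ^+ 2 / 2) * gauss_pdf x <= 1.
Proof.
have p1 : normal_peak (1 : R) <= 1.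
  rewrite /normal_peak expr1n mul1r invf_le1; last first.
    by rewrite sqrtr_gt0 mulrn_wgt0// pi_gt0.
  rewrite -[leLHS]sqrtr1 ler_sqrt; last by rewrite mulrn_wge0// ltW// pi_gt0.
  by have := @pi_ge2 R; rewrite mulr2n; lra.
rewrite gauss_pdfE mulrCA -[leRHS]mulr1 ler_pM ?normal_peak_ge0//.
  by rewrite mulr_ge0 ?expR_ge0// addr_ge0// divr_ge0 ?sqr_ge0.
by rewrite expRN ler_pdivrMr ?expR_gt0// mul1r expR_ge1Dx.
Qed.

Lemma gauss_pdf_le1 x : gauss_pdf x <= 1.
Proof.
have := gauss_pdf_bound x; have := gauss_pdf_gt0 x; have := sqr_ge0 x; nra.
Qed.

Lemma mul_gauss_pdf_le1 x : `|x * gauss_pdf x| <= 1.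
Proof.
rewrite normrM (gtr0_norm (gauss_pdf_gt0 x)).
apply: le_trans (gauss_pdf_bound x).
rewrite ler_wpM2r ?(ltW (gauss_pdf_gt0 x))//.
rewrite -(real_normK (num_real x)); have := sqr_ge0 (`|x| - 1); nra.
Qed.

Lemma gauss_pdf_second_le2 x : `|(x ^+ 2 - 1) * gauss_pdf x| <= 2.
Proof.
rewrite normrM (gtr0_norm (gauss_pdf_gt0 x)).
have h : `|x ^+ 2 - 1| <= 2 * (1 + x ^+ 2 / 2).
  by have := sqr_ge0 x; rewrite ler_norml => ?; apply/andP; split; lra.
apply: (@le_trans _ _ (2 * (1 + x ^+ 2 / 2) * gauss_pdf x)).
  by rewrite ler_wpM2r// ltW// gauss_pdf_gt0.
by rewrite -mulrA -[leRHS]mulr1 ler_wpM2l// gauss_pdf_bound.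
Qed.

Lemma has_derivative_gauss_pdf x :
  has_derivative gauss_pdf x (- x * gauss_pdf x).
Proof.
have sq : has_derivative (fun t : R => t * t * (- 2^-1)) x (- x).
  apply: has_derivative_eq (has_derivative_mul (has_derivative_mul
    (has_derivative_id x) (has_derivative_id x)) (has_derivative_cst _ x)) _.
  by lra.
have e := @has_derivative_comp _ expR (fun t => t * t * (- 2^-1)) x _ _ (is_derive_expR _) sq.
have h := has_derivative_mul (has_derivative_cst (normal_peak 1) x) e.
apply: (has_derivative_ext _ (has_derivative_eq h _)) => [t|].
  by rewrite gauss_pdfE expr2 mulrN.
by rewrite gauss_pdfE expr2 mulrN; ring.
Qed.

Lemma has_derivative_gauss_pdf2 x :
  has_derivative (fun t => - t * gauss_pdf t) x ((x ^+ 2 - 1) * gauss_pdf x).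
Proof.
have n : has_derivative (fun t : R => - t) x (- 1).
  apply: (has_derivative_ext _ (has_derivative_affine (-1) 0 x)) => t.
  by rewrite mulN1r addr0.
apply: (has_derivative_eq (has_derivative_mul n (has_derivative_gauss_pdf x))).
by ring.
Qed.

(** The second derivative of the density is bounded, hence a uniform cubic
    remainder: multiplied by [N = h ^- 2] it still vanishes. *)
Lemma gauss_cdf_taylor x k :
  `|gauss_cdf (x + k) - gauss_cdf x - gauss_pdf x * k
     - (- x * gauss_pdf x) * k ^+ 2 / 2| <= 2 * `|k| ^+ 3.
Proof.
apply: (@taylor2_le _ _ _ (fun z => - z * gauss_pdf z)
  (fun z => (z ^+ 2 - 1) * gauss_pdf z)) => z.
- exact: has_derivative_gauss_cdf.
- exact: has_derivative_gauss_pdf.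
- exact: has_derivative_gauss_pdf2.
- exact: gauss_pdf_second_le2.
Qed.

Lemma gauss_cdf_lip x k : `|gauss_cdf (x + k) - gauss_cdf x| <= `|k|.
Proof.
rewrite -[leRHS]mul1r.
apply: (@le_norm_of_derive_le _ (fun t => gauss_cdf (x + t) - gauss_cdf x)
  (fun t => gauss_pdf (x + t))).
- by rewrite addr0 subrr.
- move=> t _.
  have sh : has_derivative (fun s : R => x + s) t 1.
    apply: (has_derivative_ext _ (has_derivative_affine 1 x t)) => s.
    by rewrite mul1r addrC.
  apply: (has_derivative_eq (has_derivative_sub (has_derivative_comp
    (has_derivative_gauss_cdf _) sh) (has_derivative_cst (gauss_cdf x) t))).
  by rewrite mulr1 subr0.
- by move=> t _; rewrite ger0_norm ?gauss_pdf_le1// ltW// gauss_pdf_gt0.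
Qed.

Let idTR : measurableTypeR R -> R := idfun.

#[local] HB.instance Definition _ :=
  @isMeasurableFun.Build _ _ _ _ idTR (@measurable_id _ _ setT).

Lemma gauss_cdf_cvgy : gauss_cdf x @[x --> +oo] --> (1 : R).
Proof. exact: fine_cvg (cvg_cdfy1 (idTR : {RV (normal_prob 0 1) >-> R})). Qed.

Lemma gauss_cdf_cvgNy : gauss_cdf x @[x --> -oo] --> (0 : R).
Proof. exact: fine_cvg (cvg_cdfNy0 (idTR : {RV (normal_prob 0 1) >-> R})). Qed.

(** [gauss_cdf (- x) + gauss_cdf x] has zero derivative and limit 1 at infinity. *)
Lemma gauss_cdfN x : gauss_cdf (- x) = 1 - gauss_cdf x.
Proof.
have c y : gauss_cdf (- y) + gauss_cdf y = gauss_cdf (- x) + gauss_cdf x.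
  apply: (@is_derive_0_is_cst _ (fun t => gauss_cdf (- t) + gauss_cdf t)) => t.
  have n : has_derivative (fun t : R => - t) t (- 1).
    apply: (has_derivative_ext _ (has_derivative_affine (-1) 0 t)) => s.
    by rewrite mulN1r addr0.
  apply: (has_derivative_eq (has_derivative_add (has_derivative_comp
    (has_derivative_gauss_cdf _) n) (has_derivative_gauss_cdf t))).
  by rewrite !gauss_pdfE sqrrN mulrN1 addNr.
have l : gauss_cdf (- y) + gauss_cdf y @[y --> +oo] --> (0 + 1 : R).
  apply: cvgD; last exact: gauss_cdf_cvgy.
  exact: (iffLR (cvgNy_compNP gauss_cdf _) gauss_cdf_cvgNy).
have l' : gauss_cdf (- y) + gauss_cdf y @[y --> +oo] -->
    gauss_cdf (- x) + gauss_cdf x.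
  by under eq_fun do rewrite c; exact: cvg_cst.
apply/eqP; rewrite eq_sym subr_eq eq_sym; apply/eqP.
rewrite -[RHS]add0r; exact: cvg_unique _ l' l.
Qed.

Lemma lt_gauss_cdf x y : x < y -> gauss_cdf x < gauss_cdf y.
Proof.
move=> xy.
have [||c _ e] := @MVT_segment _ gauss_cdf gauss_pdf x y (ltW xy).
- by move=> z _; exact: has_derivative_gauss_cdf.
- apply: derivable_within_continuous => z _.
  by case: (has_derivative_gauss_cdf z).
- by rewrite -subr_gt0 e mulr_gt0 ?gauss_pdf_gt0// subr_gt0.
Qed.

Lemma continuous_gauss_cdf : continuous gauss_cdf.
Proof. by move=> x; exact: has_derivative_continuous (has_derivative_gauss_cdf x). Qed.

End GaussianDistributionFunction.

(** * A cutoff with Lipschitz derivative *)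

Section Cutoff.
Context {R : realType}.
Implicit Types a x e z : R.

Definition pos_part z : R := Num.max 0 z.

Lemma pos_part_ge0 z : 0 <= pos_part z.
Proof. by rewrite /pos_part le_max lexx. Qed.

Lemma pos_part_eq0 z : z <= 0 -> pos_part z = 0.
Proof. by rewrite /pos_part => h; rewrite max_l. Qed.

Lemma pos_part_id z : 0 <= z -> pos_part z = z.
Proof. by rewrite /pos_part => h; rewrite max_r. Qed.

Lemma pos_partB z : pos_part z - pos_part (- z) = z.
Proof.
have [z0|z0] := leP 0 z.
  by rewrite pos_part_id// pos_part_eq0 ?oppr_le0// subr0.
by rewrite pos_part_eq0 ?ltW// pos_part_id ?sub0r ?opprK// oppr_ge0 ltW.
Qed.

Lemma pos_part_le_norm z : pos_part z <= `|z|.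
Proof. by rewrite /pos_part ge_max normr_ge0 ler_norm. Qed.

(** The square of the positive part is differentiable with a Lipschitz
    derivative, including at 0; this is all the smoothness the cutoff needs. *)
Lemma pos_part_sqr_taylor z e :
  `|pos_part (z + e) ^+ 2 - pos_part z ^+ 2 - 2 * pos_part z * e| <= e ^+ 2.
Proof.
have [z0|z0] := leP 0 z; have [h|h] := leP 0 (z + e);
  rewrite ?(pos_part_id z0) ?(pos_part_id h) ?(pos_part_eq0 (ltW z0))
    ?(pos_part_eq0 (ltW h)) ler_norml; apply/andP; split; nra.
Qed.

(** Supported in [|x| <= a], equal to 1 at 0, and decreasing in [|x|]: the
    monotonicity is what gives the drift of the cutoff its sign. *)
Definition cutoff a x : R := pos_part (1 - (x / a) ^+ 2) ^+ 2.

Definition cutoff_slope a x : R :=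
  - (4 * x / a ^+ 2) * pos_part (1 - (x / a) ^+ 2).

Lemma cutoff_ge0 a x : 0 <= cutoff a x.
Proof. exact: sqr_ge0. Qed.

Lemma pos_part_le1 a x : pos_part (1 - (x / a) ^+ 2) <= 1.
Proof. by rewrite /pos_part ge_max ler01 gerBl sqr_ge0. Qed.

Lemma cutoff_le1 a x : cutoff a x <= 1.
Proof. by rewrite expr_le1// ?pos_part_le1// pos_part_ge0. Qed.

Lemma cutoff0 a : cutoff a 0 = 1.
Proof. by rewrite /cutoff mul0r expr0n/= subr0 pos_part_id// expr1n. Qed.

Lemma pos_part_far a x : 0 < a -> a <= `|x| -> pos_part (1 - (x / a) ^+ 2) = 0.
Proof.
move=> a0 ax; apply: pos_part_eq0; rewrite subr_le0 -real_normK ?num_real//.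
by rewrite expr_ge1// normrM normfV (gtr0_norm a0) ler_pdivlMr// mul1r.
Qed.

Lemma cutoff_far a x : 0 < a -> a <= `|x| -> cutoff a x = 0.
Proof. by move=> a0 ax; rewrite /cutoff pos_part_far// expr0n. Qed.

Lemma cutoff_slope_far a x : 0 < a -> a <= `|x| -> cutoff_slope a x = 0.
Proof. by move=> a0 ax; rewrite /cutoff_slope pos_part_far// mulr0. Qed.

Lemma cutoff_slope_le a x : 0 < a -> `|x| <= 2 * a -> `|cutoff_slope a x| <= 8 / a.
Proof.
move=> a0 xa; rewrite /cutoff_slope mulNr normrN normrM.
rewrite (ger0_norm (pos_part_ge0 _)) -[leRHS]mulr1.
rewrite ler_pM ?normr_ge0 ?pos_part_ge0 ?pos_part_le1//.
rewrite !normrM normfV (ger0_norm (_ : 0 <= 4)) // (ger0_norm (sqr_ge0 a)).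
rewrite ler_pdivrMr ?exprn_gt0// expr2 mulrA divfK ?gt_eqF//; lra.
Qed.

(** The bound on [x] covers the points from which a jump can enter the support. *)
Lemma cutoff_taylor a x e : 0 < a -> `|x| <= 2 * a -> `|e| <= a ->
  `|cutoff a (x + e) - cutoff a x - cutoff_slope a x * e| <= 27 / a ^+ 2 * e ^+ 2.
Proof.
move=> a0 xa ea.
set z := 1 - (x / a) ^+ 2; set dz := - (2 * x * e + e ^+ 2) / a ^+ 2.
have an0 : a != 0 by rewrite gt_eqF.
have zE : 1 - ((x + e) / a) ^+ 2 = z + dz by rewrite /z /dz; field.
have T1 := pos_part_sqr_taylor z dz.
rewrite /cutoff zE /cutoff_slope -/z.
have p0 := pos_part_ge0 z; have p1 : pos_part z <= 1 by exact: pos_part_le1.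
have a2 : 0 < a ^+ 2 by rewrite exprn_gt0.
have b1 : dz ^+ 2 <= 25 / a ^+ 2 * e ^+ 2.
  have n1 : `|2 * x + e| <= 5 * a.
    by rewrite (le_trans (ler_normD _ _))// normrM ger0_norm//; lra.
  have -> : dz ^+ 2 = (2 * x + e) ^+ 2 / (a ^+ 2 * a ^+ 2) * e ^+ 2.
    by rewrite /dz; field.
  rewrite ler_wpM2r ?sqr_ge0// ler_pdivrMr ?mulr_gt0// mulrA divfK ?gt_eqF//.
  rewrite -real_normK ?num_real// (_ : 25 * a ^+ 2 = (5 * a) ^+ 2); last by ring.
  by rewrite lerXn2r ?nnegrE// mulr_ge0// ltW.
have q0 : 0 <= e ^+ 2 / a ^+ 2 by rewrite divr_ge0 ?sqr_ge0.
have b2 : `|2 * pos_part z * (e ^+ 2 / a ^+ 2)| <= 2 / a ^+ 2 * e ^+ 2.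
  rewrite ger0_norm; last by rewrite mulr_ge0// mulr_ge0.
  rewrite (_ : 2 / a ^+ 2 * e ^+ 2 = 2 * 1 * (e ^+ 2 / a ^+ 2)); last by field.
  by rewrite ler_wpM2r// ler_wpM2l.
have -> : pos_part (z + dz) ^+ 2 - pos_part z ^+ 2 -
    - (4 * x / a ^+ 2) * pos_part z * e =
    (pos_part (z + dz) ^+ 2 - pos_part z ^+ 2 - 2 * pos_part z * dz)
    - 2 * pos_part z * (e ^+ 2 / a ^+ 2).
  by rewrite /dz; field.
rewrite (le_trans (ler_normB _ _))// (le_trans (lerD T1 b2))//.
rewrite (le_trans (lerD b1 (lexx _)))// -mulrDl -mulrDl.
by rewrite (_ : 25 + 2 = 27)//; ring.
Qed.

Lemma has_derivative_cutoff a x : 0 < a ->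
  has_derivative (cutoff a) x (cutoff_slope a x).
Proof.
move=> a0.
have sq (z : R) : has_derivative (fun t => pos_part t ^+ 2) z (2 * pos_part z).
  apply: (@has_derivative_of_quadratic _ _ _ _ 1) => e.
  by rewrite mul1r pos_part_sqr_taylor.
have h : has_derivative (fun t : R => 1 - (t / a) ^+ 2) x (- (2 * x / a ^+ 2)).
  have l := has_derivative_affine a^-1 0 x.
  have := has_derivative_sub (has_derivative_cst 1 x) (has_derivative_mul l l).
  move=> h; apply: (has_derivative_ext _ (has_derivative_eq h _)) => [t|].
    by rewrite addr0 [a^-1 * t]mulrC expr2.
  by rewrite addr0; field; rewrite gt_eqF.
apply: (has_derivative_eq (has_derivative_comp (sq _) h)).
by rewrite /cutoff_slope; ring.
Qed.

Lemma continuous_cutoff_slope a : continuous (cutoff_slope a).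
Proof.
move=> x; rewrite /cutoff_slope /pos_part.
apply: cvgM.
  by apply: cvgN; apply: cvgM; [apply: cvgM; [exact: cvg_cst|exact: cvg_id]|exact: cvg_cst].
have cm : {for x, continuous ((fun=> 0 : R^o) \max (fun t : R => 1 - (t / a) ^+ 2 : R^o))}.
  apply: continuous_max; first exact: cvg_cst.
  apply: cvgB; first exact: cvg_cst.
  by apply: cvgM; apply: cvgM; (exact: cvg_id || exact: cvg_cst).
exact: cm.
Qed.

End Cutoff.

(** * The drift of the test function *)

Section GeneratorInequality.
Context {R : realType}.

Lemma ge_opp_norm (x b : R) : `|x| <= b -> - b <= x.
Proof. by rewrite ler_norml => /andP[]. Qed.

Lemma normM_le (x y a b : R) : `|x| <= a -> `|y| <= b -> `|x * y| <= a * b.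
Proof. by move=> xa yb; rewrite normrM ler_pM. Qed.

(** Here [P] is the normalized intensity, [h = 1 / sqrt N] the size of a jump of
    [y], and [x = h * y].  With [w] differentiated along the backward equation,
    the terms [m / h] cancel and what remains is the sum of four terms: the
    error in the linear expansion of [P] (bounded because [y * gauss_pdf w] is),
    the effect of [P - 1] on the second derivative (small with the support [a]
    of the cutoff), the drift of the cutoff (nonnegative), and Taylor
    remainders of order [h]. *)
Lemma generator_ge (u eta a B c P h m rho y w : R) :
  0 <= eta -> eta <= u -> 0 < a -> 0 < h <= 1 -> h ^+ 2 <= a ->
  0 <= rho <= B -> `|m| <= 1 -> `|h * y| <= 2 * a ->
  0 <= P -> `|P - 1 + u * (h * y)| <= eta * `|h * y| ->
  w = (m * y - c) * rho ->
  - (eta * (1 + `|c| * B) + 2 * u * a * B ^+ 2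
     + h * ((1 + 4 * u * a) * (2 * B ^+ 3 + 27 / a ^+ 2
              + B * (8 / a + 27 / a ^+ 2)))) <=
  gauss_pdf w * ((u * m * y - m / h) * rho + w * m ^+ 2 * rho ^+ 2 / 2)
    * cutoff a (h * y)
  - gauss_cdf w * cutoff_slope a (h * y)
  + h ^- 2 * (P * (gauss_cdf (w + m * rho * h) * cutoff a (h * y + h ^+ 2)
               - gauss_cdf w * cutoff a (h * y))).
Proof.
move=> eta0 etau a0 /andP[h0 h1] h2a /andP[r0 rB] m1 xa P0 PE wE.
set x := h * y in xa PE *; set k := m * rho * h.
have B0 : 0 <= B := le_trans r0 rB.
have u0 : 0 <= u := le_trans eta0 etau.
have hn0 : h != 0 by rewrite gt_eqF.
have R1 := gauss_cdf_taylor w k.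
have h2n : `|h ^+ 2| <= a by rewrite ger0_norm// sqr_ge0.
have R2 := cutoff_taylor a0 xa h2n.
have L1 := gauss_cdf_lip w k.
have S1 := cutoff_slope_le a0 xa.
have G1 := mul_gauss_pdf_le1 w.
have f0 := gauss_pdf_gt0 w; have f1 := gauss_pdf_le1 w.
have F0 := gauss_cdf_ge0 w; have F1 := gauss_cdf_le1 w.
have c0 := cutoff_ge0 a x; have c1 := cutoff_le1 a x.
(* the intensity pushes [x] towards 0, the cutoff increases in that direction *)
have slopeE : (P - 1) * cutoff_slope a x >= 0.
  rewrite /cutoff_slope; set p := pos_part _.
  have p0 : 0 <= p := pos_part_ge0 _.
  have e : (P - 1) * x <= 0.
    have := ler_norm (P - 1 + u * x) ; have := ler_norm (- (P - 1 + u * x)).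
    rewrite normrN; move: PE eta0 etau; clear.
    by have [x0|x0] := ger0P x => *; nra.
  have -> : (P - 1) * (- (4 * x / a ^+ 2) * p) = - ((P - 1) * x) * (4 / a ^+ 2 * p).
    by field; rewrite gt_eqF.
  by rewrite mulr_ge0 ?oppr_ge0// mulr_ge0// divr_ge0// sqr_ge0.
have P1 : `|P - 1| <= 4 * u * a.
  rewrite (_ : P - 1 = (P - 1 + u * x) - u * x); last by ring.
  rewrite (le_trans (ler_normB _ _))// (le_trans (lerD PE (lexx _)))//.
  rewrite [`|u * x|]normrM (ger0_norm u0) -mulrDl.
  by move: (normr_ge0 x) xa etau u0; clear => *; nra.
have PB : P <= 1 + 4 * u * a.
  by move: (ler_norm (P - 1)) P1; clear; lra.
have kB : `|k| <= B * h.
  rewrite /k normrM (ger0_norm (ltW h0)) ler_wpM2r ?(ltW h0)//.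
  by rewrite -[leRHS]mul1r; apply: normM_le => //; rewrite ger0_norm.
move: R1 R2 L1; set F := gauss_cdf w; set F2 := gauss_cdf (w + k).
set f := gauss_pdf w; set C := cutoff a x; set C2 := cutoff a (x + h ^+ 2).
set C' := cutoff_slope a x.
set r1 := F2 - F - _ - _; set r2 := C2 - C - _ => R1 R2 L1.
set lhs := (X in _ <= X).
have -> : lhs = C * (f * m * rho * (u * y + (P - 1) / h))
   + C * ((w * f) * (m ^+ 2 * rho ^+ 2 / 2) * (1 - P))
   + (P - 1) * C' * F
   + P * (C * (r1 / h ^+ 2) + F * (r2 / h ^+ 2) + (F2 - F) * ((C2 - C) / h ^+ 2)).
  by rewrite /lhs /r1 /r2 -/F -/F2 -/f -/C -/C2 -/C' /k; field.
(* error of the expansion of [P]; [f * m * rho * y] is bounded since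
   [m * y * rho = w + c * rho] *)
have TA : `|C * (f * m * rho * (u * y + (P - 1) / h))| <= eta * (1 + `|c| * B).
  have -> : u * y + (P - 1) / h = (P - 1 + u * x) / h by rewrite /x; field.
  have yb : `|(P - 1 + u * x) / h| <= eta * `|y|.
    rewrite normrM normfV (gtr0_norm h0) ler_pdivrMr// (le_trans PE)//.
    by rewrite /x normrM (gtr0_norm h0) mulrCA mulrC.
  have fy : `|f * m * rho| * `|y| <= 1 + `|c| * B.
    rewrite -normrM (_ : f * m * rho * y = w * f + c * rho * f); last by rewrite wE; ring.
    rewrite (le_trans (ler_normD _ _))// lerD//.
    rewrite -[leRHS]mulr1; apply: normM_le; last by rewrite ger0_norm// ltW.
    by apply: normM_le => //; rewrite ger0_norm.
  rewrite -[leRHS]mul1r; apply: normM_le; first by rewrite ger0_norm.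
  rewrite normrM (le_trans (ler_wpM2l (normr_ge0 _) yb))//.
  by rewrite mulrCA ler_wpM2l.
(* effect of [P - 1] on the second-order term *)
have TB : `|C * ((w * f) * (m ^+ 2 * rho ^+ 2 / 2) * (1 - P))| <= 2 * u * a * B ^+ 2.
  rewrite (_ : 2 * u * a * B ^+ 2 = 1 * (1 * (1 * B ^+ 2 / 2) * (4 * u * a))); last by field.
  apply: normM_le; first by rewrite ger0_norm.
  apply: normM_le; last by rewrite distrC.
  apply: normM_le; first by [].
  apply: normM_le; last by rewrite ger0_norm.
  apply: normM_le; rewrite normrX; first by rewrite expr_le1.
  by rewrite lerXn2r ?nnegrE// ger0_norm.
have TC : 0 <= (P - 1) * C' * F by rewrite mulr_ge0.
have h20 : 0 < h ^+ 2 by rewrite exprn_gt0.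
(* Taylor remainders *)
have D1 : `|r1 / h ^+ 2| <= 2 * B ^+ 3 * h.
  rewrite normrM normfV (gtr0_norm h20) ler_pdivrMr// (le_trans R1)//.
  rewrite (_ : 2 * B ^+ 3 * h * h ^+ 2 = 2 * (B * h) ^+ 3); last by ring.
  by rewrite ler_wpM2l// lerXn2r ?nnegrE// mulr_ge0// ltW.
have a20 : 0 <= 27 / a ^+ 2 by rewrite divr_ge0// sqr_ge0.
have hh : h ^+ 2 <= h by rewrite expr2 ler_piMl// ltW.
have D2 : `|r2 / h ^+ 2| <= 27 / a ^+ 2 * h.
  rewrite normrM normfV (gtr0_norm h20) ler_pdivrMr// (le_trans R2)//.
  by rewrite [(h ^+ 2) ^+ 2]expr2 mulrA ler_wpM2r ?sqr_ge0// ler_wpM2l.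
have D3 : `|(F2 - F) * ((C2 - C) / h ^+ 2)| <= B * h * (8 / a + 27 / a ^+ 2).
  apply: normM_le; first exact: le_trans L1 kB.
  have -> : (C2 - C) / h ^+ 2 = C' + r2 / h ^+ 2 by rewrite /r2 /C'; field.
  rewrite (le_trans (ler_normD _ _))// lerD// (le_trans D2)// ler_piMr//.
have TD : `|P * (C * (r1 / h ^+ 2) + F * (r2 / h ^+ 2)
     + (F2 - F) * ((C2 - C) / h ^+ 2))| <=
   h * ((1 + 4 * u * a) * (2 * B ^+ 3 + 27 / a ^+ 2 + B * (8 / a + 27 / a ^+ 2))).
  rewrite [leRHS]mulrCA; apply: normM_le; first by rewrite ger0_norm.
  rewrite (_ : h * _ = 1 * (2 * B ^+ 3 * h) + 1 * (27 / a ^+ 2 * h)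
    + B * h * (8 / a + 27 / a ^+ 2)); last by ring.
  rewrite (le_trans (ler_normD _ _))// lerD//.
  rewrite (le_trans (ler_normD _ _))// lerD//; apply: normM_le => //;
    by rewrite ger0_norm.
move: (ge_opp_norm TA) (ge_opp_norm TB) TC (ge_opp_norm TD); clear; lra.
Qed.

End GeneratorInequality.

(** * Explicit solutions of the backward equation *)

Section BackwardSolution.
Context {R : realType}.

Lemma has_derivative_inv_sqrt (f : R -> R) (x df : R) :
  0 < f x -> has_derivative f x df ->
  has_derivative (fun t => (Num.sqrt (f t))^-1) x
    (- df * (Num.sqrt (f x))^-1 ^+ 3 / 2).
Proof.
move=> f0 d.
have s0 : 0 < Num.sqrt (f x) by rewrite sqrtr_gt0.
have [h1 h2] := has_derivative_comp (is_derive1_sqrt f0) d.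
have sn0 : (fun t => Num.sqrt (f t)) x != 0 by rewrite /= gt_eqF.
apply: DeriveDef; first exact: derivableV.
rewrite deriveV// h2 /GRing.scale/=; field.
by rewrite gt_eqF.
Qed.

(** The functions [m] and [q] for which [Phi ((m s * y - c) / sqrt (q s))] solves
    the backward Ornstein-Uhlenbeck equation; the sign of [m] is free. *)
Definition backward_pair (u b : R) (m q : R -> R) : Prop :=
  forall s, 0 <= s <= 1 ->
  [/\ has_derivative m s (u * m s), has_derivative q s (- (m s) ^+ 2),
      b <= q s & `|m s| <= 1].

Definition ou_score (m q : R -> R) (c h s x : R) : R :=
  (m s * (x / h) - c) / Num.sqrt (q s).

(** As a function of [s] at a fixed state: between two events
    [x = v - s], where [v] is the number of events over [N] and [s] the fraction
    of the horizon elapsed. *)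
Definition ou_test (m q : R -> R) (c h a v s : R) : R :=
  gauss_cdf (ou_score m q c h s (v - s)) * cutoff a (v - s).

Definition ou_test_slope (m q : R -> R) (u c h a v s : R) : R :=
  let w := ou_score m q c h s (v - s) in
  gauss_pdf w * ((u * m s * ((v - s) / h) - m s / h) * (Num.sqrt (q s))^-1
                 + w * m s ^+ 2 * (Num.sqrt (q s))^-1 ^+ 2 / 2)
    * cutoff a (v - s)
  - gauss_cdf w * cutoff_slope a (v - s).

Context (u b : R) (m q : R -> R) (b0 : 0 < b) (mq : backward_pair u b m q).
Context (c h a : R) (h0 : 0 < h) (a0 : 0 < a).

Lemma backward_var_gt0 (s : R) : 0 <= s <= 1 -> 0 < q s.
Proof. by move=> /mq[_ _ + _]; exact: lt_le_trans. Qed.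

Lemma has_derivative_ou_score (v s : R) : 0 <= s <= 1 ->
  let w := ou_score m q c h s (v - s) in
  has_derivative (fun t => ou_score m q c h t (v - t)) s
    ((u * m s * ((v - s) / h) - m s / h) * (Num.sqrt (q s))^-1
                 + w * m s ^+ 2 * (Num.sqrt (q s))^-1 ^+ 2 / 2).
Proof.
move=> s01 w; have q0 := backward_var_gt0 s01.
have [dm dq _ _] := mq s01.
have dr := has_derivative_inv_sqrt q0 dq.
have dy : has_derivative (fun t => (v - t) / h) s (- h^-1).
  apply: (has_derivative_ext _ (has_derivative_affine (- h^-1) (v / h) s)) => t.
  by rewrite mulrBl; lra.
have dn := has_derivative_sub (has_derivative_mul dm dy) (has_derivative_cst c s).
apply: (has_derivative_eq (has_derivative_mul dn dr)).
by rewrite /w /ou_score; field; rewrite !gt_eqF// sqrtr_gt0.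
Qed.

Lemma has_derivative_ou_test (v s : R) : 0 <= s <= 1 ->
  has_derivative (ou_test m q c h a v) s (ou_test_slope m q u c h a v s).
Proof.
move=> s01.
have dw := has_derivative_comp (has_derivative_gauss_cdf _) (has_derivative_ou_score v s01).
have dx : has_derivative (fun t : R => v - t) s (- 1).
  apply: (has_derivative_ext _ (has_derivative_affine (-1) v s)) => t.
  by rewrite mulN1r addrC.
have dc := has_derivative_comp (has_derivative_cutoff _ a0) dx.
apply: (has_derivative_eq (has_derivative_mul dw dc)).
by rewrite /ou_test_slope; ring.
Qed.

Lemma continuous_ou_test_slope (v s : R) : 0 <= s <= 1 ->
  {for s, continuous (ou_test_slope m q u c h a v)}.
Proof.
move=> s01; have q0 := backward_var_gt0 s01; have [dm dq _ _] := mq s01.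
have cm := has_derivative_continuous dm.
have cr := has_derivative_continuous (has_derivative_inv_sqrt q0 dq).
have cw := has_derivative_continuous (has_derivative_ou_score v s01).
have dx : has_derivative (fun t : R => v - t) s (- 1).
  apply: (has_derivative_ext _ (has_derivative_affine (-1) v s)) => t.
  by rewrite mulN1r addrC.
have cx := has_derivative_continuous dx.
have cc := has_derivative_continuous (has_derivative_comp (has_derivative_cutoff _ a0) dx).
have cs : {for s, continuous (fun t => cutoff_slope a (v - t))}.
  by apply: continuous_comp cx _; exact: continuous_cutoff_slope.
have cf : {for s, continuous (fun t => gauss_pdf (ou_score m q c h t (v - t)))}.
  apply: continuous_comp cw _.
  exact: has_derivative_continuous (has_derivative_gauss_pdf _).
have cF : {for s, continuous (fun t => gauss_cdf (ou_score m q c h t (v - t)))}.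
  by apply: continuous_comp cw _; exact: continuous_gauss_cdf.
have k (z : R) : {for s, continuous (fun _ : R => z)} by exact: cvg_cst.
have M (f g : R -> R) : {for s, continuous f} -> {for s, continuous g} ->
    {for s, continuous (fun t => f t * g t)} by exact: continuousM.
have X2 (f : R -> R) : {for s, continuous f} -> {for s, continuous (fun t => f t ^+ 2)}.
  by move=> cf'; rewrite /continuous_at/=; apply: M.
have A (f g : R -> R) : {for s, continuous f} -> {for s, continuous g} ->
    {for s, continuous (fun t => f t + g t)} by exact: continuousD.
have B (f g : R -> R) : {for s, continuous f} -> {for s, continuous g} ->
    {for s, continuous (fun t => f t - g t)} by exact: continuousB.
apply: (B); last exact: (M).
apply: (M _ _ _ cc); apply: (M _ _ cf); apply: (A).
  apply: (M _ _ _ cr); apply: (B); last exact: (M _ _ cm (k _)).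
  by apply: (M); apply: (M) => //; exact: (k).
by apply: (M _ _ _ (k _)); apply: (M _ _ _ (X2 _ cr)); exact: (M _ _ cw (X2 _ cm)).
Qed.

Lemma ou_test_bounds (v s : R) : 0 <= ou_test m q c h a v s <= 1.
Proof.
rewrite mulr_ge0 ?gauss_cdf_ge0 ?cutoff_ge0//=.
by rewrite mulr_ile1 ?gauss_cdf_ge0 ?cutoff_ge0 ?gauss_cdf_le1 ?cutoff_le1.
Qed.

Lemma ou_test_far (v s : R) : a <= `|v - s| -> ou_test m q c h a v s = 0.
Proof. by move=> h'; rewrite /ou_test cutoff_far// mulr0. Qed.

Lemma ou_test_slope_far (v s : R) :
  a <= `|v - s| -> ou_test_slope m q u c h a v s = 0.
Proof.
by move=> h'; rewrite /ou_test_slope cutoff_far// cutoff_slope_far// !mulr0 subr0.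
Qed.

(** The expansion of the normalized intensity [P] is required only for
    [|v - s| <= 2 * a]: beyond, the cutoff vanishes both before and after a
    jump, so the drift is 0 whatever [P]. *)
Lemma ou_test_drift_ge (v s P eta B : R) :
  0 <= s <= 1 -> 0 <= eta <= u -> h <= 1 -> h ^+ 2 <= a -> 0 <= P ->
  (`|v - s| <= 2 * a -> `|P - 1 + u * (v - s)| <= eta * `|v - s|) ->
  B = (Num.sqrt b)^-1 ->
  - (eta * (1 + `|c| * B) + 2 * u * a * B ^+ 2
     + h * ((1 + 4 * u * a) * (2 * B ^+ 3 + 27 / a ^+ 2
              + B * (8 / a + 27 / a ^+ 2)))) <=
  ou_test_slope m q u c h a v s
  + h ^- 2 * (P * (ou_test m q c h a (v + h ^+ 2) s - ou_test m q c h a v s)).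
Proof.
move=> s01 /andP[eta0 etau] h1 h2a P0 PE BE.
have B0 : 0 <= B by rewrite BE invr_ge0 sqrtr_ge0.
have u0 : 0 <= u := le_trans eta0 etau.
have [xa|xa] := leP `|v - s| (2 * a); last first.
  have h2n : `|h ^+ 2| <= a by rewrite ger0_norm// sqr_ge0.
  have f1 : a <= `|v - s| by have a0' := a0; lra.
  have f2 : a <= `|v + h ^+ 2 - s|.
    have := ler_normB (v + h ^+ 2 - s) (h ^+ 2).
    rewrite (_ : v + h ^+ 2 - s - h ^+ 2 = v - s); last by ring.
    have a0' := a0; lra.
  rewrite (ou_test_slope_far f1) (ou_test_far f1) (ou_test_far f2).
  rewrite subrr !mulr0 addr0 oppr_le0.
  have A0 : 0 <= 27 / a ^+ 2 by rewrite divr_ge0// sqr_ge0.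
  have A1 : 0 <= 8 / a by rewrite divr_ge0// ltW.
  have B2 := exprn_ge0 2 B0; have B3 := exprn_ge0 3 B0.
  have a0' := ltW a0; have h0' := ltW h0.
  have t1 : 0 <= 1 + `|c| * B by rewrite addr_ge0// mulr_ge0.
  have t2 : 0 <= 1 + 4 * u * a by rewrite addr_ge0// !mulr_ge0.
  have t3 : 0 <= 2 * B ^+ 3 + 27 / a ^+ 2 + B * (8 / a + 27 / a ^+ 2).
    by rewrite addr_ge0 ?(mulr_ge0 B0)// addr_ge0// mulr_ge0.
  by rewrite !addr_ge0// mulr_ge0// !mulr_ge0.
have [_ _ qb m1] := mq s01.
have yE : h * ((v - s) / h) = v - s by rewrite mulrCA divff ?mulr1// gt_eqF.
have up : ou_test m q c h a (v + h ^+ 2) s =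
    gauss_cdf (ou_score m q c h s (v - s) + m s * (Num.sqrt (q s))^-1 * h)
    * cutoff a (v - s + h ^+ 2).
  rewrite /ou_test (_ : v + h ^+ 2 - s = v - s + h ^+ 2); last by ring.
  congr (gauss_cdf _ * _); rewrite /ou_score; field.
  by rewrite !gt_eqF// sqrtr_gt0 backward_var_gt0.
rewrite up /ou_test_slope /ou_test.
have := @generator_ge _ u eta a B c P h (m s) (Num.sqrt (q s))^-1 ((v - s) / h)
  (ou_score m q c h s (v - s)) eta0 etau a0.
rewrite yE h0 h1 /= => /(_ isT h2a) gg. apply: gg => //.
- rewrite BE invr_ge0 sqrtr_ge0/= lef_pV2 ?posrE ?sqrtr_gt0 ?(backward_var_gt0 s01)//.
  by rewrite ler_sqrt// ltW// (lt_le_trans b0).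
- exact: PE.
Qed.

End BackwardSolution.

(** * Event times of a counting path *)

Section CountingPath.
Context {R : realType}.
Implicit Types (x : R -> nat) (t s T : R) (k j n : nat).

Lemma counting_path_le x s t : counting_path x -> 0 <= s -> s <= t ->
  (x s <= x t)%N.
Proof. by move=> [_ + _ _]; exact. Qed.

Lemma has_inf_event x k t : 0 <= t -> (k <= x t)%N ->
  has_inf [set s | 0 <= s /\ (k <= x s)%N].
Proof. by move=> t0 kt; split; [exists t | exists 0 => s []]. Qed.

Lemma event_time_le x k t : 0 <= t -> (k <= x t)%N -> event_time x k <= t.
Proof.
by move=> t0 kt; apply: (ge_inf (has_inf_event t0 kt).2).
Qed.

Lemma event_time_ge0 x k t : 0 <= t -> (k <= x t)%N -> 0 <= event_time x k.
Proof.
move=> t0 kt; have [ne _] := has_inf_event t0 kt.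
by apply: lb_le_inf => // s [].
Qed.

(** Right-continuity: the infimum is attained. *)
Lemma event_time_reached x k t : counting_path x ->
  0 <= t -> (k <= x t)%N -> (k <= x (event_time x k))%N.
Proof.
move=> hx t0 kt; set e := event_time x k.
have e0 : 0 <= e := event_time_ge0 t0 kt.
have [_ mono rc _] := hx.
have [d /= d0 hd] := rc e e0.
have [s [s0 ks] se] := inf_adherent d0 (has_inf_event t0 kt).
have es : e <= s by exact: event_time_le.
have [->|ne] := eqVneq e s; first by [].
have els : e < s by rewrite lt_neqAle ne.
rewrite -(hd s) //=.
by rewrite ltr0_norm ?subr_lt0// opprB ltrBlDl.
Qed.

(** The set of times where the count is at least [k] is a closed half-line, which
    turns statements on [x] into comparisons with event times. *)
Lemma event_time_leP x k t T : counting_path x -> 0 <= t -> 0 <= T ->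
  (k <= x T)%N -> (event_time x k <= t) = (k <= x t)%N.
Proof.
move=> hx t0 T0 kT; apply/idP/idP; last exact: event_time_le.
move=> et; apply: leq_trans (event_time_reached hx T0 kT) _.
by apply: counting_path_le => //; exact: event_time_ge0 kT.
Qed.

Lemma event_time_gt0 x k T : counting_path x -> 0 <= T -> (0 < k <= x T)%N ->
  0 < event_time x k.
Proof.
move=> hx T0 /andP[k0 kT]; rewrite ltNge (event_time_leP _ _ T0)//.
by have [-> _ _ _] := hx; rewrite -ltnNge.
Qed.

(** Just before the event the count is below [k], and it grows by at most 1. *)
Lemma event_time_value x k T : counting_path x -> 0 <= T -> (0 < k <= x T)%N ->
  x (event_time x k) = k.
Proof.
move=> hx T0 kk; have /andP[k0 kT] := kk.
have e0 := event_time_gt0 hx T0 kk.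
apply/eqP; rewrite eqn_leq (event_time_reached hx T0 kT) andbT.
have [_ _ _ lc] := hx; have lc' := lc _ e0.
have : \forall s \near (event_time x k)^'-, (0 < s)%R /\ s < event_time x k.
  near=> s; split; near: s; last exact: nbhs_left_lt.
  exact: nbhs_left_gt.
move=> near_s; have [s [jump [s0 se]]] := @filter_ex _ _ (at_left_proper_filter _) _ (filterI lc' near_s).
apply: leq_trans jump _.
by rewrite ltnNge -(event_time_leP hx (ltW s0) T0 kT) -ltNge.
Unshelve. all: by end_near.
Qed.

Lemma event_time_lt x k T : counting_path x -> 0 <= T -> (0 < k < x T)%N ->
  event_time x k < event_time x k.+1.
Proof.
move=> hx T0 /andP[k0 kT].
have h : (0 < k <= x T)%N by rewrite k0 ltnW.
rewrite ltNge (event_time_leP hx _ T0)//; last exact: ltW (event_time_gt0 hx T0 h).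
by rewrite (event_time_value hx T0 h) ltnn.
Qed.

(** [before x t j] says that the left limit of [x] at [t] is at least [j]; the
    rational times make it a countable union of predictable events. *)
Definition before x t j : Prop :=
  exists q : rat, [/\ 0 <= ratr q :> R, ratr q < t & (j <= x (ratr q))%N].

Lemma beforeP x t j : counting_path x ->
  before x t j <-> exists2 s, 0 <= s < t & (j <= x s)%N.
Proof.
move=> hx; split=> [[q [q0 qt jq]]|[s /andP[s0 st] js]].
  by exists (ratr q) => //; rewrite q0.
have [q] := rat_in_itvoo st; rewrite in_itv/= => /andP[sq qt].
have sq' := ltW sq.
exists q; split => //; first exact: le_trans s0 sq'.
by apply: leq_trans js _; exact: counting_path_le.
Qed.

Lemma before0 x t : 0 < t -> before x t 0.
Proof. by move=> t0; exists 0; rewrite rmorph0. Qed.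

Lemma before_event x t j T : counting_path x -> 0 <= T -> (j <= x T)%N ->
  before x t j <-> event_time x j < t.
Proof.
move=> hx T0 jT; rewrite beforeP//; split=> [[s /andP[s0 st] js]|et].
  by apply: le_lt_trans st; exact: event_time_le.
exists (event_time x j); last exact: event_time_reached jT.
by rewrite et (event_time_ge0 T0 jT).
Qed.

Lemma before_le x t j : counting_path x -> before x t j -> (j <= x t)%N.
Proof.
move=> hx /(beforeP _ _ hx)[s /andP[s0 st] js].
by apply: leq_trans js _; apply: counting_path_le => //; exact: ltW.
Qed.

(** The left limit at event [k] is [k - 1]: so [c (t) 1 (x (t-) = n)] charges
    event [n.+1] only. *)
Lemma before_at_event x k j T : counting_path x -> 0 <= T -> (0 < k <= x T)%N ->
  before x (event_time x k) j <-> (j < k)%N.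
Proof.
move=> hx T0 kk; have /andP[k0 kT] := kk; split.
  move=> /(beforeP _ _ hx)[s /andP[s0 st] js].
  apply: leq_ltn_trans js _; rewrite ltnNge.
  by rewrite -(event_time_leP hx s0 T0 kT) -ltNge.
move=> jk; have [->|j0] := posnP j.
  by apply: before0; exact: event_time_gt0 kk.
have jT : (j < x T)%N := leq_trans jk kT.
apply/(before_event _ hx T0 (ltnW jT)).
have l : event_time x j < event_time x j.+1 by apply: event_time_lt hx T0 _; rewrite j0.
apply: lt_le_trans l _; rewrite (event_time_leP hx _ T0 jT)//.
  by rewrite (event_time_value hx T0 kk).
exact: ltW (event_time_gt0 hx T0 kk).
Qed.

(** Off an event time, left limits are values. *)
Lemma before_off_event x t j : counting_path x -> 0 < t ->
  t != event_time x j -> before x t j <-> (j <= x t)%N.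
Proof.
move=> hx t0 te; split; first exact: before_le.
move=> jt; apply/(before_event _ hx (ltW t0) jt).
by rewrite lt_neqAle eq_sym te event_time_le// ltW.
Qed.

End CountingPath.

(** * Change of variables along a counting path *)

Section IntervalIntegrals.
Context {R : realType}.
Local Notation mu := (@lebesgue_measure R).

Lemma integrable_realD (D : set (measurableTypeR R)) (f g : R -> R) : measurable D ->
  mu.-integrable D (EFin \o f) -> mu.-integrable D (EFin \o g) ->
  mu.-integrable D (EFin \o (fun t => f t + g t)).
Proof. by move=> mD fi gi; exact: (integrableD mD fi gi). Qed.

Lemma eq_integrable_real (D : set (measurableTypeR R)) (f g : R -> R) : measurable D ->
  {in D, f =1 g} -> mu.-integrable D (EFin \o f) -> mu.-integrable D (EFin \o g).
Proof.
by move=> mD fg; apply: eq_integrable => // t tD; rewrite /= fg.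
Qed.

Lemma Rintegral_sum_nat (D : set (measurableTypeR R)) (F : nat -> R -> R) M : measurable D ->
  (forall n, mu.-integrable D (EFin \o F n)) ->
  mu.-integrable D (EFin \o (fun t => \sum_(0 <= n < M) F n t)) /\
  Rintegral mu D (fun t => \sum_(0 <= n < M) F n t) =
  \sum_(0 <= n < M) Rintegral mu D (F n).
Proof.
move=> mD iF; elim: M => [|M [ihi ihE]].
  rewrite big_nil; split.
    rewrite (_ : EFin \o _ = cst 0%E); last by apply/funext => t /=; rewrite big_nil.
    exact: integrable0.
  by under eq_Rintegral do rewrite big_nil; rewrite Rintegral_cst// mul0r.
have e : (fun t => \sum_(0 <= n < M.+1) F n t) =
    (fun t => (\sum_(0 <= n < M) F n t) + F M t).
  by apply/funext => t; rewrite big_nat_recr.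
rewrite e big_nat_recr//= -ihE; split; last exact: RintegralD.
exact: (@integrable_realD _ (fun t => \sum_(0 <= n < M) F n t) (F M)).
Qed.

Lemma continuous_integrable_itv (f : R -> R) (a b : R) :
  (forall t, a <= t <= b -> {for t, continuous f}) ->
  mu.-integrable `[a, b] (EFin \o f).
Proof.
move=> cf; apply: continuous_compact_integrable; first exact: segment_compact.
apply: continuous_in_subspaceT => t; rewrite inE/= in_itv/=; exact: cf.
Qed.

(** The fundamental theorem of calculus, for two-sided derivatives at the ends. *)
Lemma Rintegral_derivative (f df : R -> R) (a b : R) : a <= b ->
  (forall t, a <= t <= b -> has_derivative f t (df t)) ->
  (forall t, a <= t <= b -> {for t, continuous df}) ->
  Rintegral mu `[a, b] df = f b - f a.
Proof.
rewrite le_eqVlt => /predU1P[<- _ _|ab hf hdf].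
  by rewrite set_itv1 Rintegral_set1 subrr.
have cf t : a <= t <= b -> {for t, continuous f}.
  by move=> /hf; exact: has_derivative_continuous.
have aa : a <= a <= b by rewrite lexx ltW.
have bb : a <= b <= b by rewrite lexx ltW.
rewrite /Rintegral (continuous_FTC2 (F := f) ab)//.
- apply: continuous_in_subspaceT => t; rewrite inE/= in_itv/=; exact: hdf.
- split; [|exact: cvg_at_right_filter (cf _ aa)|exact: cvg_at_left_filter (cf _ bb)].
  move=> t; rewrite in_itv/= => /andP[ta tb].
  by have [] : has_derivative f t (df t) by apply: hf; rewrite !ltW.
- move=> t; rewrite in_itv/= => /andP[ta tb].
  have [_] : has_derivative f t (df t) by apply: hf; rewrite !ltW.
  by rewrite derive1E.
Qed.

End IntervalIntegrals.

Section PathwiseFormula.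
Context {R : realType}.
Local Notation mu := (@lebesgue_measure R).
Implicit Types (x : R -> nat) (t s T : R) (k j n : nat).

Lemma count_patch x T n (f : R -> R) : counting_path x -> 0 <= T ->
  {in `[0, T]%classic, (fun t => (n <= x t)%:R * f t) =1
    (if (n <= x T)%N then f \_ `[event_time x n, +oo[ else cst 0)}.
Proof.
move=> hx T0 t; rewrite inE/= in_itv/= => /andP[t0 tT].
case: (boolP (n <= x T)%N) => nT; last first.
  rewrite /= (_ : (n <= x t)%N = false) ?mul0r//.
  by apply/negbTE; apply: contra nT => /leq_trans; apply; exact: counting_path_le.
rewrite patchE -(event_time_leP hx t0 T0 nT) mem_setE in_itv/= andbT.
by case: ifP => _; rewrite ?mul1r ?mul0r.
Qed.

Lemma integrable_count x T n (f : R -> R) : counting_path x -> 0 <= T ->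
  mu.-integrable `[0, T] (EFin \o f) ->
  mu.-integrable `[0, T] (EFin \o (fun t => (n <= x t)%:R * f t)).
Proof.
move=> hx T0 fi.
apply: (@eq_integrable_real _ `[0, T]
  (if (n <= x T)%N then f \_ `[event_time x n, +oo[ else cst 0)) => //.
  by move=> t tT; rewrite (count_patch n f hx T0 tT).
case: ifP => _; last by rewrite (_ : EFin \o cst 0 = cst 0%E)//; exact: integrable0.
rewrite -restrict_EFin; apply/integrable_restrict => //.
by apply: integrableS fi => //; exact: measurableI.
Qed.

Lemma Rintegral_count x T n (f : R -> R) : counting_path x -> 0 <= T ->
  Rintegral mu `[0, T] (fun t => (n <= x t)%:R * f t) =
  (n <= x T)%:R * Rintegral mu `[event_time x n, T] f.
Proof.
move=> hx T0; transitivity (Rintegral mu `[0, T]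
    (if (n <= x T)%N then f \_ `[event_time x n, +oo[ else cst 0)).
  exact: (eq_Rintegral mu (count_patch n f hx T0)).
case: ifP => nT; last by rewrite Rintegral_cst// !mul0r.
rewrite mul1r -Rintegral_mkcondr; congr (Rintegral _ _ _).
have e0 := event_time_ge0 T0 nT.
apply/seteqP; split=> t /=; rewrite !in_itv/= ?andbT.
  by move=> [/andP[_ ->] ->].
by move=> /andP[et ->]; rewrite et (le_trans e0 et).
Qed.

(** The indicator of [n <= x t] is that of [t >= event_time x n], so this is the
    fundamental theorem of calculus between the event and the horizon. *)
Lemma count_derivative x T n (D D' : R -> R) : counting_path x -> 0 <= T ->
  (forall t, 0 <= t <= T -> has_derivative D t (D' t)) ->
  (forall t, 0 <= t <= T -> {for t, continuous D'}) ->
  (n <= x T)%:R * D T = (n <= x T)%:R * D (event_time x n)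
    + Rintegral mu `[0, T] (fun t => (n <= x t)%:R * D' t).
Proof.
move=> hx T0 dD cD; rewrite Rintegral_count//.
case: (boolP (n <= x T)%N) => nT; last by rewrite !mul0r addr0.
have e0 := event_time_ge0 T0 nT; have eT := event_time_le T0 nT.
rewrite !mul1r (@Rintegral_derivative _ D)//; first by rewrite addrC subrK.
- by move=> t /andP[et tT]; apply: dD; rewrite (le_trans e0 et).
- by move=> t /andP[et tT]; apply: cD; rewrite (le_trans e0 et).
Qed.

(** Abel summation: it expresses a function of the count through the indicators
    [n < j], whose evolution along a path is a single switch. *)
Lemma telescope_count (M j : nat) (f : nat -> R) :
  (forall n, (M <= n)%N -> f n = 0) ->
  f j = f 0%N + \sum_(0 <= n < M) (n.+1 <= j)%:R * (f n.+1 - f n).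
Proof.
move=> fM; wlog jM : j / (j <= M)%N => [h|].
  have [/h//|Mj] := leqP j M.
  have -> : f j = f M by rewrite !fM// ltnW.
  rewrite (h M)//; congr (_ + _).
  apply: eq_big_seq => n; rewrite mem_index_iota => /andP[_ nM].
  by rewrite nM (ltn_trans nM Mj).
rewrite (big_cat_nat (n := j))//= [X in _ + (_ + X)]big1_seq; last first.
  move=> n; rewrite mem_index_iota => /andP[_ /andP[jn _]].
  by rewrite ltnNge jn mul0r.
rewrite addr0 (eq_big_nat _ _ (F2 := fun n => f n.+1 - f n)); last first.
  by move=> n /andP[_ nj]; rewrite nj mul1r.
by rewrite telescope_sumr// addrC subrK.
Qed.

(** Between events only time moves; the [n]-th summand is the jump from [n] to
    [n.+1].  The vanishing of [f] beyond [M] makes the sum finite whatever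
    the number of events. *)
Lemma path_formula x T M (f g : R -> nat -> R) : counting_path x -> 0 <= T ->
  (forall n t, 0 <= t <= T -> has_derivative (f^~ n) t (g t n)) ->
  (forall n t, 0 <= t <= T -> {for t, continuous (g^~ n)}) ->
  (forall n t, (M <= n)%N -> 0 <= t <= T -> f t n = 0) ->
  (forall n t, (M <= n)%N -> 0 <= t <= T -> g t n = 0) ->
  mu.-integrable `[0, T] (EFin \o (fun t => g t (x t))) /\
  f T (x T) = f 0 0%N + Rintegral mu `[0, T] (fun t => g t (x t))
    + \sum_(0 <= n < M) (n.+1 <= x T)%:R *
        (f (event_time x n.+1) n.+1 - f (event_time x n.+1) n).
Proof.
move=> hx T0 df cg fM gM.
have TT : 0 <= T <= T by rewrite T0 lexx.
have dD n t : 0 <= t <= T ->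
    has_derivative (fun s => f s n.+1 - f s n) t (g t n.+1 - g t n).
  by move=> tT; apply: has_derivative_sub; exact: df.
have cD n t : 0 <= t <= T -> {for t, continuous (fun s => g s n.+1 - g s n)}.
  by move=> tT; apply: continuousB; exact: cg.
have iD n := integrable_count n.+1 hx T0 (continuous_integrable_itv (cD n)).
have mD : measurable (`[0, T]%classic : set (measurableTypeR R)) by [].
have i0 : mu.-integrable `[0, T] (EFin \o (g^~ 0%N)).
  exact: continuous_integrable_itv (cg 0%N).
have [iS ES] := Rintegral_sum_nat M mD iD.
have gE : {in `[0, T]%classic, (fun t => g t (x t)) =1 (fun t => g t 0%N +
    \sum_(0 <= n < M) (n.+1 <= x t)%:R * (g t n.+1 - g t n))}.
  move=> t; rewrite inE/= in_itv/= => tT; apply: telescope_count => n Mn.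
  exact: gM.
split.
  apply: (@eq_integrable_real _ `[0, T] (fun t => g t 0%N +
    \sum_(0 <= n < M) (n.+1 <= x t)%:R * (g t n.+1 - g t n))) => //.
    by move=> t tT; rewrite gE.
  exact: integrable_realD.
have -> : Rintegral mu `[0, T] (fun t => g t (x t)) = Rintegral mu `[0, T]
    (fun t => g t 0%N + \sum_(0 <= n < M) (n.+1 <= x t)%:R * (g t n.+1 - g t n)).
  exact: (eq_Rintegral mu gE).
rewrite RintegralD// ES.
rewrite (Rintegral_derivative (f := f^~ 0%N) T0)//; [|exact: df|exact: cg].
rewrite [LHS](@telescope_count M _ (f T)); last by move=> n Mn; exact: fM.
rewrite (addrA (f 0 0%N)) subrKC -addrA -big_split/=.
congr (_ + _); apply: eq_bigr => n _; rewrite addrC.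
exact: (count_derivative n.+1 hx T0 (dD n) (cD n)).
Qed.

End PathwiseFormula.

(** * Predictability of left limits *)

Section GeneratedSigmaAlgebra.
Context {U : Type} (D : set U) (G : set (set U)).

Lemma gen_setU A B : <<s D, G >> A -> <<s D, G >> B -> <<s D, G >> (A `|` B).
Proof.
move=> hA hB; rewrite -bigcup2E; apply: sigma_algebra_bigcup => -[|[|n]] //=.
exact: sigma_algebra0.
Qed.

Lemma gen_setI A B : <<s D, G >> A -> <<s D, G >> B ->
  <<s D, G >> (D `&` (A `&` B)).
Proof.
move=> hA hB; rewrite (_ : _ `&` _ = D `\` ((D `\` A) `|` (D `\` B))).
  by apply: sigma_algebraCD; apply: gen_setU; exact: sigma_algebraCD.
apply/seteqP; split=> p /=; first by move=> [Dp [Ap Bp]]; split=> // -[][].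
move=> [Dp h]; split=> //; split; apply: contrapT => n; apply: h; [left|right] => //.
Qed.

Lemma gen_setT : <<s D, G >> D.
Proof. by have := sigma_algebraCD (@sigma_algebra0 _ D G); rewrite setD0. Qed.

Lemma gen_bigcup_count (I : countType) (A : I -> set U) :
  (forall i, <<s D, G >> (A i)) -> <<s D, G >> (\bigcup_i A i).
Proof.
move=> hA.
rewrite (_ : \bigcup_i A i =
    \bigcup_k (if unpickle k is Some i then A i else set0)).
  apply: sigma_algebra_bigcup => k; case: unpickle => [i|]; first exact: hA.
  exact: sigma_algebra0.
apply/seteqP; split=> p [].
  by move=> i _ Ai; exists (pickle i); rewrite // pickleK.
by move=> k _; case: unpickle => [i Ai|//]; exists i.
Qed.

End GeneratedSigmaAlgebra.

(** Open half-lines generate the Borel sets, and their traces on [[0, T]] are the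
    deterministic intervals among the generators of the predictable sets. *)
Lemma borel_sub {R : realType} (H : set (set R)) : sigma_algebra setT H ->
  (forall a : R, H `]a, +oo[%classic) -> forall A : set R, measurable A -> H A.
Proof.
move=> sH Ha A.
have sub : <<s @RGenOInfty.G R >> `<=` H.
  by apply: smallest_sub => // _ [a ->].
have mE := RGenOInfty.measurableE R.
by move=> mA; apply: sub; have := mA; rewrite [measurable]mE.
Qed.

Section Predictable.
Context {R : realType} {d : measure_display} {Omega : measurableType d}.
Context (X : R -> Omega -> nat) (T : R).
Local Notation F := (natural_filtration X).
Local Notation Sigma := (predictable_sigma F T).
Local Notation D := (`[0, T]%classic `*` [set: Omega]).

Lemma filtrationT t : F t setT.
Proof. exact: gen_setT. Qed.

Lemma filtration_event t (B : set nat) : 0 <= t -> F t (X t @^-1` B).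
Proof. by move=> t0; apply: sub_sigma_algebra; exists t, B; rewrite lexx. Qed.

Lemma predictable_time (A : set R) : measurable A ->
  Sigma ((`[0, T] `&` A) `*` [set: Omega]).
Proof.
pose H := [set A : set R | Sigma ((`[0, T] `&` A) `*` [set: Omega])].
apply: (@borel_sub _ H).
  split=> [|B HB|B HB].
  - by rewrite /H/= setI0 set0X; exact: sigma_algebra0.
  - rewrite /H/= (_ : _ `*` _ = D `\` ((`[0, T] `&` B) `*` setT)).
      exact: sigma_algebraCD.
    apply/seteqP; split=> -[t w] /=; first by move=> [[tT [_ nB]] _]; split => // -[[]].
    by move=> [[tT _] n]; split=> //; split => //; split => // Bt; apply: n.
  - rewrite /H/= (_ : _ `*` _ = \bigcup_k ((`[0, T] `&` B k) `*` setT)).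
      by apply: sigma_algebra_bigcup => k; exact: HB.
    apply/seteqP; split=> -[t w] /=; first by move=> [[tT [k _ Bk]] _]; exists k.
    by move=> [k _ [[tT Bk] _]]; split => //; split => //; exists k.
move=> a; rewrite /H/=.
have [a0|a0] := ltP a 0.
  rewrite (_ : _ `&` _ = `[0, T]%classic); first exact: gen_setT.
  apply/setIidl => t /=; rewrite !in_itv/= andbT => /andP[t0 _].
  exact: lt_le_trans t0.
have [aT|Ta] := leP a T; last first.
  rewrite (_ : _ `&` _ = set0) ?set0X; first exact: sigma_algebra0.
  rewrite -subset0 => t [] /=; rewrite !in_itv/= andbT => /andP[_ tT] at'.
  by have := lt_trans (le_lt_trans tT Ta) at'; rewrite ltxx.
apply: sub_sigma_algebra; left; exists a, T, setT.
split => //; first exact: filtrationT.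
congr (_ `*` _); apply/seteqP; split=> t /=; rewrite !in_itv/= ?andbT.
  by move=> [/andP[_ ->] ->].
by move=> /andP[at' ->]; rewrite at' (ltW (le_lt_trans a0 at')).
Qed.

(** The left limit reaches [j] before [t] when the count does at some rational
    [q < t], an event known at time [q] and then integrated over [(q, T]]. *)
Lemma predictable_before j :
  Sigma (D `&` [set p | before (X ^~ p.2) p.1 j]).
Proof.
pose A (q : rat) : set (R * Omega) := if (0 <= ratr q :> R) && (ratr q <= T) then
     `]ratr q, T]%classic `*` (X (ratr q) @^-1` [set m | (j <= m)%N]) else set0.
rewrite (_ : _ `&` _ = \bigcup_q A q).
  apply: gen_bigcup_count => q; rewrite /A.
  case: ifP => [/andP[q0 qT]|_]; last exact: sigma_algebra0.
  apply: sub_sigma_algebra; left.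
  exists (ratr q), T, (X (ratr q) @^-1` [set m | (j <= m)%N]).
  by split => //; exact: filtration_event.
apply/seteqP; split=> -[t w] /=.
  rewrite in_itv/= => -[[/andP[t0 tT] _] [q [q0 qt jq]]].
  exists q; first by [].
  rewrite /A q0 (le_trans (ltW qt) tT)/=.
  by split; rewrite //= in_itv/= qt.
move=> [q _]; rewrite /A.
case: ifP => [/andP[q0 qT]|//] [/=]; rewrite in_itv/= => /andP[qt tT] jq.
rewrite in_itv/= tT (le_trans q0 (ltW qt)); split => //.
by exists q.
Qed.

(** For [0 < t] this says that the left limit of [x] at [t] is [n], without
    taking a limit; it is false at [t = 0], where no event is charged. *)
Definition left_at (x : R -> nat) (t : R) (n : nat) : Prop :=
  before x t n /\ ~ before x t n.+1.

Definition crossing (c : R -> R) (x : R -> nat) (n : nat) (t : R) : R :=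
  c t * (`[< left_at x t n >])%:R.

(** A deterministic factor is predictable, and the state enters through two
    instances of [before]. *)
Lemma predictable_crossing (c : R -> R) n : measurable_fun setT c ->
  predictable F T (fun t w => crossing c (X ^~ w) n t).
Proof.
move=> mc B mB.
pose E := D `&` [set p : R * Omega | left_at (X ^~ p.2) p.1 n].
have SE : Sigma E.
  rewrite (_ : E = D `&` ((D `&` [set p | before (X ^~ p.2) p.1 n]) `&`
     (D `\` (D `&` [set p | before (X ^~ p.2) p.1 n.+1])))).
    by apply: gen_setI; [|apply: sigma_algebraCD]; exact: predictable_before.
  apply/seteqP; split=> p /=.
    by move=> [Dp [b nb]]; split=> //; split=> //; split=> // -[].
  by move=> [Dp [[_ b] [_ nb]]]; split=> //; split=> // b'; apply: nb.
have SK : Sigma ((`[0, T] `&` c @^-1` B) `*` [set: Omega]).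
  by apply: predictable_time; rewrite -[_ @^-1` _]setTI; exact: mc.
have [B0|B0] := pselect (B 0).
  rewrite (_ : _ `&` _ = (D `\` E) `|`
     (D `&` (((`[0, T] `&` c @^-1` B) `*` setT) `&` E))).
    by apply: gen_setU; [exact: sigma_algebraCD|exact: gen_setI].
  apply/seteqP; split=> -[t w] /=; rewrite /crossing.
    move=> [Dp]; case: asboolP => l; rewrite ?mulr1 ?mulr0 => Bc; [right|left].
      by split => //; split => //; split => //; case: Dp.
    by split => // -[].
  move=> [[Dp nE]|[Dp [[[_ Bc] _] [_ l]]]]; split => //.
    by case: asboolP => l; rewrite ?mulr0//; exfalso; apply: nE.
  by rewrite asboolT// mulr1.
rewrite (_ : _ `&` _ = D `&` (((`[0, T] `&` c @^-1` B) `*` setT) `&` E)).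
  exact: gen_setI.
apply/seteqP; split=> -[t w] /=; rewrite /crossing.
  move=> [Dp]; case: asboolP => l; rewrite ?mulr1 ?mulr0 => Bc //.
  by split => //; split => //; split => //; case: Dp.
by move=> [Dp [[[_ Bc] _] [_ l]]]; split => //; rewrite asboolT// mulr1.
Qed.

End Predictable.

(** * Integrals of crossing integrands along a path *)

Section CrossingPathIntegral.
Context {R : realType}.
Local Notation mu := (@lebesgue_measure R).
Implicit Types (x : R -> nat) (c : R -> R) (t T : R) (n : nat).

Lemma path_integral_crossing x c T n : counting_path x -> 0 <= T ->
  path_integral x T (crossing c x n) =
  (n.+1 <= x T)%:R * c (event_time x n.+1).
Proof.
move=> hx T0; rewrite /path_integral.
rewrite (eq_big_seq (fun k => (k == n.+1)%:R * c (event_time x k))); last first.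
  move=> k; rewrite mem_index_iota ltnS => kk.
  rewrite /crossing mulrC; congr ((nat_of_bool _)%:R * _); apply/idP/idP.
    move=> /asboolP[/(before_at_event _ hx T0 kk) nk nb].
    rewrite eqn_leq nk andbT leqNgt; apply/negP => nk'.
    exact/nb/(before_at_event _ hx T0 kk).
  move=> /eqP kn; apply/asboolP; split; first by apply/(before_at_event _ hx T0 kk); rewrite kn.
  by move=> /(before_at_event _ hx T0 kk); rewrite kn ltnn.
have [nT|nT] := boolP (n.+1 <= x T)%N; last first.
  rewrite mul0r big1_seq// => k; rewrite mem_index_iota ltnS => /andP[_ /andP[_ kT]].
  case: eqP => [kn|]; last by rewrite mul0r.
  by move: nT; rewrite -kn kT.
rewrite (big_cat_nat (n := n.+1))//=; last by rewrite ltnW.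
rewrite big1_seq ?add0r; last first.
  move=> k; rewrite mem_index_iota => /andP[_ /andP[_ kn]].
  by rewrite ltn_eqF// mul0r.
rewrite big_ltn// eqxx big1_seq ?addr0// => k.
rewrite mem_index_iota => /andP[_ /andP[nk _]].
by rewrite gtn_eqF// mul0r.
Qed.

(** Left limits and values differ at event times only, so the integrand may be
    read off the current state almost everywhere. *)
Lemma crossing_off_event x c t n : counting_path x -> 0 < t ->
  t != event_time x n -> t != event_time x n.+1 ->
  crossing c x n t = c t * (x t == n)%:R.
Proof.
move=> hx t0 t1 t2; congr (_ * (nat_of_bool _)%:R); apply/asboolP/eqP; rewrite /left_at.
  move=> [/(before_off_event hx t0 t1) nt nb].
  apply/eqP; rewrite eqn_leq nt andbT leqNgt; apply/negP => h.
  exact/nb/(before_off_event hx t0 t2).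
move=> xn; split; first by apply/(before_off_event hx t0 t1); rewrite xn.
by move=> /(before_off_event hx t0 t2); rewrite xn ltnn.
Qed.

Lemma measurable_fun_setD1 (D : set R) (r : R) (f : R -> \bar R) :
  measurable D -> measurable_fun (D `\ r) f -> measurable_fun D f.
Proof.
move=> mD mf; have [Dr|NDr] := pselect (D r); last by rewrite -(not_setD1 NDr).
rewrite -(setD1K Dr); apply/measurable_funU => //; first exact: measurableD.
by split => //; exact: measurable_fun_set1.
Qed.

(** Changing a measurable function at finitely many points keeps it measurable
    and keeps its integral. *)
Lemma integral_off_three (D : set R) (a b e : R)
    (f g : R -> \bar R) : measurable D -> measurable_fun D g ->
  (forall t, D t -> t != a -> t != b -> t != e -> f t = g t) ->
  (\int[mu]_(t in D) f t = \int[mu]_(t in D) g t)%E.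
Proof.
move=> mD mg fg.
have m1 : measurable (D `\ a) by exact: measurableD.
have m2 : measurable (D `\ a `\ b) by exact: measurableD.
have m3 : measurable (D `\ a `\ b `\ e) by exact: measurableD.
have mf3 : measurable_fun (D `\ a `\ b `\ e) f.
  apply: (eq_measurable_fun g); last by apply: measurable_funS mg => // t [[[]]].
  move=> t; rewrite inE => -[[[Dt /eqP ta] /eqP tb] /eqP te].
  by rewrite fg.
have mf2 := measurable_fun_setD1 m2 mf3.
have mf1 := measurable_fun_setD1 m1 mf2.
rewrite -(integral_setD1 m1 mf1) -(integral_setD1 m2 mf2) -(integral_setD1 m3 mf3).
have mg3 : measurable_fun (D `\ a `\ b `\ e) g.
  by apply: measurable_funS mg => // t [[[]]].
have mg2 := measurable_fun_setD1 m2 mg3.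
have mg1 := measurable_fun_setD1 m1 mg2.
rewrite -(integral_setD1 m1 mg1) -(integral_setD1 m2 mg2) -(integral_setD1 m3 mg3).
apply: eq_integral => t; rewrite inE => -[[[Dt /eqP ta] /eqP tb] /eqP te].
by rewrite fg.
Qed.

(** The infimum defining [event_time] is 0 when the event never occurs; moving
    it beyond the horizon makes it a measurable function of the path for which
    [capped_time_le] holds unconditionally. *)
Definition capped_time x T n : R :=
  if (n <= x T)%N then event_time x n else T + 1.

Lemma capped_time_le x T n t : counting_path x -> 0 <= t <= T ->
  (capped_time x T n <= t) = (n <= x t)%N.
Proof.
move=> hx /andP[t0 tT]; have T0 := le_trans t0 tT.
rewrite /capped_time; case: ifPn => nT; first exact: event_time_leP nT.
rewrite [RHS]negbTE; last first.
  by apply: contra nT => /leq_trans; apply; exact: counting_path_le.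
by apply/negbTE; rewrite -ltNge; lra.
Qed.

Lemma capped_time_ge0 x T n : 0 <= T -> 0 <= capped_time x T n.
Proof.
move=> T0; rewrite /capped_time; case: ifPn => nT; last by lra.
exact: event_time_ge0 nT.
Qed.

End CrossingPathIntegral.

(** * Times spent in a state *)

Section BoundedIntegrable.
Context {d : measure_display} {U : measurableType d} {R : realType}.
Context (nu : {measure set U -> \bar R}).

Lemma bounded_integrable (A : set U) (f : U -> R) (K : R) : measurable A ->
  (nu A < +oo)%E -> measurable_fun A f -> (forall p, A p -> `|f p| <= K) ->
  nu.-integrable A (EFin \o f).
Proof.
move=> mA nuA mf fK; apply: measurable_bounded_integrable => //.
exists K; split; first exact: num_real.
by move=> M KM p Ap; apply: le_trans (fK p Ap) (ltW KM).
Qed.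

End BoundedIntegrable.

Section LebesgueInterval.
Context {R : realType}.
Local Notation mu := (@lebesgue_measure R).

Lemma lebesgue_itv0 (T : R) : 0 <= T -> mu `[0, T]%classic = T%:E.
Proof.
move=> T0; have := lebesgue_measure_itv (`[0, T]%R : interval R).
move=> /= e; apply: (eq_trans e); rewrite lte_fin.
by move: T0; rewrite le_eqVlt => /predU1P[<-|->]; rewrite ?ltxx// -EFinD subr0.
Qed.

Lemma lebesgue_itv0_lty (T : R) : 0 <= T -> (mu `[0%R, T]%classic < +oo)%E.
Proof. by move=> T0; rewrite (lebesgue_itv0 T0) ltry. Qed.

Lemma Rintegral_cst_itv0 (K T : R) : 0 <= T ->
  Rintegral mu `[0, T] (fun=> K) = K * T.
Proof.
move=> T0; rewrite Rintegral_cst//; congr (_ * _).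
by have := congr1 fine (lebesgue_itv0 T0).
Qed.

End LebesgueInterval.

Section CrossingBalance.
Context {R : realType} {d : measure_display} {Omega : measurableType d}.
Context (P : probability Omega R) (X : R -> Omega -> nat) (T : R)
  (L : R -> nat -> R).
Context (hX : counting_process X) (T0 : 0 < T)
  (hint : has_intensity P X T (fun t w => L t (X t w))).
Local Notation mu := (@lebesgue_measure R).

Lemma measurable_count t (B : set nat) : 0 <= t -> measurable (X t @^-1` B).
Proof. by move=> t0; rewrite -[X in measurable X]setTI; exact: (hX.1 t t0). Qed.

Lemma path_counting w : counting_path (X ^~ w).
Proof. exact: hX.2. Qed.

Lemma measurable_capped_time n :
  measurable_fun setT (fun w => capped_time (X ^~ w) T n).
Proof.
apply: (measurability _ (RGenOInfty.measurableE R)) => //.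
move=> _ [_ [a ->] <-]; rewrite setTI.
rewrite (_ : _ @^-1` _ = ~` [set w | capped_time (X ^~ w) T n <= a]); last first.
  apply/seteqP; split => w /=; rewrite in_itv/= andbT ltNge; first by move/negP.
  by move=> h; apply/negP.
apply: measurableC.
have [a0|a0] := ltP a 0.
  rewrite (_ : [set _ | _] = set0)//; apply/seteqP; split => // w /= h.
  by have := le_lt_trans (le_trans (capped_time_ge0 (X ^~ w) n (ltW T0)) h) a0; rewrite ltxx.
have [aT|aT] := leP a T.
  rewrite (_ : [set _ | _] = X a @^-1` [set m | (n <= m)%N]).
    exact: measurable_count.
  apply/seteqP; split => w /=; rewrite (capped_time_le _ (path_counting w))//;
    by rewrite a0.
have [aT1|aT1] := leP (T + 1) a.
  rewrite (_ : [set _ | _] = setT)//; apply/seteqP; split => // w _ /=.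
  rewrite /capped_time; case: ifP => // nT.
  by apply: le_trans (event_time_le (ltW T0) nT) (ltW aT).
rewrite (_ : [set _ | _] = X T @^-1` [set m | (n <= m)%N]).
  by apply: measurable_count; exact: ltW.
apply/seteqP; split => w /=; rewrite /capped_time; case: ifPn => // nT.
  by move=> h; have := le_lt_trans h aT1; rewrite ltxx.
by move=> _; apply: le_trans (event_time_le (ltW T0) nT) (ltW aT).
Qed.

(** The indicator of [X t = n] on [[0, T]], written with event times so that its
    joint measurability in time and path is immediate. *)
Definition occupation n (p : Omega * R) : R :=
  if (capped_time (X ^~ p.1) T n <= p.2) &&
     ~~ (capped_time (X ^~ p.1) T n.+1 <= p.2) then 1 else 0.

Lemma occupationE n w t : 0 <= t <= T ->
  occupation n (w, t) = (X t w == n)%:R.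
Proof.
move=> tT; rewrite /occupation/= !(capped_time_le _ (path_counting w))//.
by rewrite -leqNgt -eqn_leq eq_sym; case: eqP.
Qed.

Lemma measurable_occupation n : measurable_fun setT (occupation n).
Proof.
have m k : measurable_fun setT (fun p : Omega * R => capped_time (X ^~ p.1) T k <= p.2).
  apply: measurable_fun_ler => //.
  by apply: (measurableT_comp (measurable_capped_time k)); exact: measurable_fst.
apply: measurable_fun_ifT => //.
by apply: measurable_and => //; apply: measurableT_comp => //.
Qed.

Definition occupation_integral n (G : R -> R) (w : Omega) : R :=
  Rintegral mu `[0, T] (fun t => (X t w == n)%:R * G t).

Definition crossing_value n (c : R -> R) (w : Omega) : R :=
  (n.+1 <= X T w)%:R * c (event_time (X ^~ w) n.+1).

Section Bounded.
Context (n : nat) (G : R -> R) (K : R) (mG : measurable_fun `[0, T] G)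
  (GK : forall t, 0 <= t <= T -> `|G t| <= K).

Lemma measurable_occupation_path w :
  measurable_fun `[0, T] (fun t => (X t w == n)%:R * G t).
Proof.
apply: (eq_measurable_fun (fun t => occupation n (w, t) * G t)).
  by move=> t; rewrite inE/= in_itv/= => tT; rewrite occupationE.
apply: measurable_funM => //; apply: measurable_funTS.
exact: (measurableT_comp (measurable_occupation n) (measurable_pair1 w)).
Qed.

Lemma occupation_le w t : 0 <= t <= T -> `|(X t w == n)%:R * G t| <= K.
Proof.
move=> tT; have K0 : 0 <= K := le_trans (normr_ge0 _) (GK tT).
by case: eqP => _; rewrite ?mul1r ?mul0r ?normr0// GK.
Qed.

Lemma integrable_occupation_path w :
  mu.-integrable `[0, T] (EFin \o (fun t => (X t w == n)%:R * G t)).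
Proof.
apply: (@bounded_integrable _ _ _ _ _ _ K) => //.
- exact: lebesgue_itv0_lty (ltW T0).
- exact: measurable_occupation_path.
- by move=> t; rewrite /= in_itv/=; exact: occupation_le.
Qed.

Lemma occupation_integralE w : (occupation_integral n G w)%:E =
  (\int[mu]_(t in `[0%R, T]) ((X t w == n)%:R * G t)%:E)%E.
Proof.
rewrite /occupation_integral /Rintegral fineK//.
exact: integrable_fin_num (integrable_occupation_path w).
Qed.

Lemma occupation_integral_le w : `|occupation_integral n G w| <= K * T.
Proof.
have mD : measurable (`[0, T]%classic : set (measurableTypeR R)) by [].
have h := le_normr_Rintegral mD (integrable_occupation_path w).
apply: (le_trans h).
have -> : K * T = Rintegral mu `[0, T] (fun=> K).
  by rewrite Rintegral_cst_itv0// ltW.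
apply: le_Rintegral => //.
- have := integrable_norm (integrable_occupation_path w).
  exact: eq_integrable.
- apply: (@bounded_integrable _ _ _ _ _ _ `|K|) => //.
  exact: lebesgue_itv0_lty (ltW T0).
- by move=> t; rewrite /= in_itv/=; exact: occupation_le.
Qed.

End Bounded.

End CrossingBalance.

(** * Exchanging jumps and intensity *)

Section CrossingBalanceTheorem.
Context {R : realType} {d : measure_display} {Omega : measurableType d}.
Context (P : probability Omega R) (X : R -> Omega -> nat) (T : R)
  (L : R -> nat -> R).
Context (hX : counting_process X) (T0 : 0 < T)
  (hint : has_intensity P X T (fun t w => L t (X t w))).
Local Notation mu := (@lebesgue_measure R).

(** Tonelli's theorem, for the product of the indicator of the state and a
    deterministic density. *)
Lemma measurable_occupation_integral n (G : R -> R) (K : R) :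
  measurable_fun `[0, T] G -> (forall t, 0 <= t <= T -> 0 <= G t <= K) ->
  measurable_fun setT (occupation_integral X T n G).
Proof.
move=> mG GK.
have GK' t : 0 <= t <= T -> `|G t| <= K by move=> /GK/andP[G0 GK']; rewrite ger0_norm.
pose h (p : Omega * R) : \bar R := (occupation X T n p * (G \_ `[0, T]) p.2)%:E.
have mG' : measurable_fun setT (G \_ `[0, T]).
  by apply/(measurable_restrictT _ _).1.
have mh : measurable_fun setT h.
  apply/measurable_EFinP; apply: measurable_funM.
    exact: measurable_occupation.
  by apply: (measurableT_comp mG'); exact: measurable_snd.
have h0 p : (0 <= h p)%E.
  rewrite lee_fin mulr_ge0//; first by rewrite /occupation; case: ifP.
  rewrite patchE; case: ifPn => //; rewrite inE/= in_itv/= => pT.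
  by case/andP: (GK _ pT).
have mF := @measurable_fun_fubini_tonelli_F _ _ _ _ _ mu h mh h0.
apply/measurable_EFinP.
rewrite (_ : EFin \o _ = fubini_F mu h)//; apply/funext => w.
rewrite /comp (occupation_integralE hX T0 n mG GK') /fubini_F.
rewrite [LHS]integral_mkcond; apply: eq_integral => t _.
rewrite /h /= patchE [in RHS]patchE.
case: ifPn; last by rewrite mulr0.
by rewrite inE/= in_itv/= => tT; rewrite (occupationE hX).
Qed.

(** The defining property of the intensity, for the predictable integrand
    [c (t) 1 (X_(t-) = n)]: on the side of the path one jump remains, on the side
    of the intensity [X_(t-)] is [X_t] for almost every [t]. *)
Lemma crossing_expectation n (c : R -> R) (K : R) :
  (forall t, 0 <= c t) -> measurable_fun setT c ->
  measurable_fun `[0, T] (fun t => c t * L t n) ->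
  (forall t, 0 <= t <= T -> `|c t * L t n| <= K) ->
  (\int[P]_w (crossing_value X T n c w)%:E =
   \int[P]_w (occupation_integral X T n (fun t => c t * L t n)%R w)%:E)%E.
Proof.
move=> c0 mc mG GK; have [_ _ _ mart] := hint.
have := mart (fun t w => crossing c (X ^~ w) n t).
move=> /(_ (fun t w => mulr_ge0 (c0 t) (ler0n _ _))).
move=> /(_ (@predictable_crossing _ _ _ X T c n mc)) e.
transitivity (\int[P]_w (path_integral (X ^~ w) T (crossing c (X ^~ w) n))%:E)%E.
  apply: eq_integral => w _; rewrite path_integral_crossing ?(ltW T0)//.
  exact: path_counting.
rewrite e; apply: eq_integral => w _.
rewrite (occupation_integralE hX T0 n mG GK).
apply: (@integral_off_three _ _ 0 (event_time (X ^~ w) n) (event_time (X ^~ w) n.+1)) => //.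
  by apply/measurable_EFinP; exact: measurable_occupation_path.
move=> t; rewrite /= in_itv/= => /andP[t0 tT] tn0 t1 t2.
rewrite crossing_off_event//; last by rewrite lt_neqAle eq_sym tn0.
  by congr (_%:E); case: eqP => [->|_]; rewrite ?mulr1 ?mulr0 ?mul1r ?mul0r.
exact: path_counting.
Qed.

Lemma crossing_balance n (c : R -> R) (Kc K : R) :
  (forall t, 0 <= c t <= Kc) -> measurable_fun setT c ->
  measurable_fun `[0, T] (fun t => c t * L t n) ->
  (forall t, 0 <= t <= T -> 0 <= c t * L t n <= K) ->
  [/\ P.-integrable setT (EFin \o crossing_value X T n c),
      P.-integrable setT
        (EFin \o occupation_integral X T n (fun t => c t * L t n)) &
      Rintegral P setT (crossing_value X T n c) =
      Rintegral P setT (occupation_integral X T n (fun t => c t * L t n))].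
Proof.
move=> cK mc mG GK.
have GK' t : 0 <= t <= T -> `|c t * L t n| <= K.
  by move=> /GK/andP[G0 Gk]; rewrite ger0_norm.
have Pfin : (P setT < +oo)%E by rewrite probability_setT ltry.
split.
- apply: (@bounded_integrable _ _ _ _ _ _ Kc) => //; last first.
    move=> w _; rewrite /crossing_value.
    have /andP[c0 ck] := cK (event_time (X ^~ w) n.+1).
    by case: leqP => _; rewrite ?mul1r ?mul0r ?normr0 ?(ger0_norm c0) ?(le_trans c0).
  have e : crossing_value X T n c = (fun w => (if (n.+1 <= X T w)%N then 1 else 0)
      * c (capped_time (X ^~ w) T n.+1)).
    apply/funext => w; rewrite /crossing_value /capped_time.
    by case: ifP => _; rewrite ?mul1r ?mul0r.
  rewrite e; apply: measurable_funM.
    apply: measurable_fun_ifT => //; apply: (measurable_fun_bool true).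
    rewrite setTI (_ : _ @^-1` _ = X T @^-1` [set m | (n.+1 <= m)%N])//.
    by apply: (measurable_count hX); exact: ltW.
  by apply: (measurableT_comp mc); exact: (measurable_capped_time hX T0).
- apply: (@bounded_integrable _ _ _ _ _ _ (K * T)) => //; last first.
    by move=> w _; exact: (occupation_integral_le hX T0 n mG GK').
  exact: (measurable_occupation_integral n mG GK).
- by rewrite /Rintegral (crossing_expectation (fun t => proj1 (andP (cK t))) mc mG GK').
Qed.

Lemma occupation_integralB n (G H : R -> R) K w :
  measurable_fun `[0, T] G -> (forall t, 0 <= t <= T -> `|G t| <= K) ->
  measurable_fun `[0, T] H -> (forall t, 0 <= t <= T -> `|H t| <= K) ->
  occupation_integral X T n (fun t => G t - H t) w =
  occupation_integral X T n G w - occupation_integral X T n H w.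
Proof.
move=> mG GK mH HK.
have iG := integrable_occupation_path hX T0 n mG GK w.
have iH := integrable_occupation_path hX T0 n mH HK w.
rewrite /occupation_integral -RintegralB//.
by apply: eq_Rintegral => t _; rewrite mulrBr.
Qed.

(** Positive and negative parts are treated separately: adding a constant to [D]
    to make it nonnegative would charge times where [D] vanishes and [L] is
    arbitrary. *)
Lemma crossing_balance_signed n (D : R -> R) (Kd K : R) :
  (forall t, 0 <= t <= T -> {for t, continuous D}) ->
  (forall t, 0 <= t <= T -> `|D t| <= Kd) ->
  measurable_fun `[0, T] (fun t => D t * L t n) ->
  (forall t, 0 <= t <= T -> 0 <= L t n) ->
  (forall t, 0 <= t <= T -> `|D t * L t n| <= K) ->
  P.-integrable setT (EFin \o (fun w => crossing_value X T n D w
     - occupation_integral X T n (fun t => D t * L t n) w)) /\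
  Rintegral P setT (fun w => crossing_value X T n D w
     - occupation_integral X T n (fun t => D t * L t n) w) = 0.
Proof.
move=> cD DK mG L0 GK.
pose Dp := (fun t => pos_part (D t)) \_ `[0, T].
pose Dn := (fun t => pos_part (- D t)) \_ `[0, T].
have inT t : 0 <= t <= T -> t \in (`[0, T]%classic : set R).
  by move=> tT; rewrite inE/= in_itv.
have mDT : measurable_fun `[0, T] D.
  apply: subspace_continuous_measurable_fun => //.
  by apply: continuous_in_subspaceT => t; rewrite inE/= in_itv/=; exact: cD.
have mpos (f : R -> R) : measurable_fun `[0, T] f ->
    measurable_fun setT ((fun t => pos_part (f t)) \_ `[0, T]).
  move=> mf; apply/(measurable_restrictT _ _).1 => //.
  by apply: measurable_maxr => //; exact: measurable_cst.
have mDp : measurable_fun setT Dp by exact: mpos.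
have mDn : measurable_fun setT Dn.
  by apply: (mpos (fun t => - D t)); exact: measurableT_comp.
have Dp0 t : 0 <= Dp t <= `|Kd|.
  rewrite /Dp patchE; case: ifPn; rewrite ?lexx ?normr_ge0//.
  rewrite inE/= in_itv/= => /DK h; rewrite pos_part_ge0/=.
  by rewrite (le_trans (pos_part_le_norm _))// (le_trans h)// ler_norm.
have Dn0 t : 0 <= Dn t <= `|Kd|.
  rewrite /Dn patchE; case: ifPn; rewrite ?lexx ?normr_ge0//.
  rewrite inE/= in_itv/= => /DK h; rewrite pos_part_ge0/=.
  by rewrite (le_trans (pos_part_le_norm _))// normrN (le_trans h)// ler_norm.
have posM (z l : R) : 0 <= l -> pos_part z * l = pos_part (z * l).
  move=> l0; have [z0|z0] := leP 0 z.
    by rewrite !pos_part_id// mulr_ge0.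
  by rewrite !pos_part_eq0 ?mul0r// ?(ltW z0)// mulr_le0_ge0// ltW.
have GpE : {in `[0, T]%classic, (fun t => pos_part (D t * L t n)) =1
    (fun t => Dp t * L t n)}.
  move=> t tT; rewrite /Dp patchE tT posM//; apply: L0.
  by move: tT; rewrite inE/= in_itv.
have GnE : {in `[0, T]%classic, (fun t => pos_part (- (D t * L t n))) =1
    (fun t => Dn t * L t n)}.
  move=> t tT; rewrite /Dn patchE tT posM ?mulNr//; apply: L0.
  by move: tT; rewrite inE/= in_itv.
have mGp : measurable_fun `[0, T] (fun t => Dp t * L t n).
  apply: eq_measurable_fun GpE _.
  by apply: measurable_maxr => //; exact: measurable_cst.
have mGn : measurable_fun `[0, T] (fun t => Dn t * L t n).
  apply: eq_measurable_fun GnE _.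
  apply: measurable_maxr; first exact: measurable_cst.
  exact: measurableT_comp.
have GpK t : 0 <= t <= T -> 0 <= Dp t * L t n <= K.
  move=> tT; rewrite -GpE ?inT// pos_part_ge0/=.
  by rewrite (le_trans (pos_part_le_norm _))// GK.
have GnK t : 0 <= t <= T -> 0 <= Dn t * L t n <= K.
  move=> tT; rewrite -GnE ?inT// pos_part_ge0/=.
  by rewrite (le_trans (pos_part_le_norm _))// normrN GK.
have [ip op ep] := crossing_balance Dp0 mDp mGp GpK.
have [im om em] := crossing_balance Dn0 mDn mGn GnK.
pose Zp w := crossing_value X T n Dp w
  - occupation_integral X T n (fun t => Dp t * L t n) w.
pose Zn w := crossing_value X T n Dn w
  - occupation_integral X T n (fun t => Dn t * L t n) w.
have ZE : (fun w => crossing_value X T n D w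
     - occupation_integral X T n (fun t => D t * L t n) w) = (fun w => Zp w - Zn w).
  apply/funext => w; rewrite /Zp /Zn.
  have cE : crossing_value X T n D w =
      crossing_value X T n Dp w - crossing_value X T n Dn w.
    rewrite /crossing_value; case: (leqP n.+1 (X T w)) => nT; last by rewrite !mul0r subr0.
    have e0 := @event_time_ge0 _ (X ^~ w) _ _ (ltW T0) nT.
    have eT := @event_time_le _ (X ^~ w) _ _ (ltW T0) nT.
    by rewrite !mul1r /Dp /Dn !patchE !inT ?e0//; exact: esym (pos_partB _).
  have oE : occupation_integral X T n (fun t => D t * L t n) w =
      occupation_integral X T n (fun t => Dp t * L t n) w
      - occupation_integral X T n (fun t => Dn t * L t n) w.
    rewrite -(@occupation_integralB n _ _ K)//; last 2 first.
    - by move=> t /GpK/andP[h0 h1]; rewrite ger0_norm.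
    - by move=> t /GnK/andP[h0 h1]; rewrite ger0_norm.
    apply: eq_Rintegral => t tT; congr (_ * _).
    by rewrite -GpE// -GnE// pos_partB.
  rewrite cE oE; ring.
have mO : measurable [set: Omega] by [].
have iZp : P.-integrable setT (EFin \o Zp).
  exact: (integrableB mO ip op).
have iZn : P.-integrable setT (EFin \o Zn).
  exact: (integrableB mO im om).
have eZp : Rintegral P setT Zp = 0 by rewrite /Zp RintegralB// ep subrr.
have eZn : Rintegral P setT Zn = 0 by rewrite /Zn RintegralB// em subrr.
rewrite ZE; split; first exact: (integrableB mO iZp iZn).
by rewrite RintegralB// eZp eZn subrr.
Qed.

End CrossingBalanceTheorem.

(** * Dynkin's inequality *)

Lemma drift_arith {R : realType} (a b c1 c2 s : R) :
  - b <= c1 + c2 -> a - b + (s - c2) <= a + c1 + s.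
Proof. lra. Qed.

Section DynkinInequality.
Context {R : realType} {d : measure_display} {Omega : measurableType d}.
Context (P : probability Omega R) (X : R -> Omega -> nat) (T : R)
  (L : R -> nat -> R).
Context (hX : counting_process X) (T0 : 0 < T)
  (hint : has_intensity P X T (fun t w => L t (X t w))).
Local Notation mu := (@lebesgue_measure R).

Lemma integrable_count_fun t (phi : nat -> R) K : 0 <= t ->
  (forall n, `|phi n| <= K) -> P.-integrable setT (EFin \o (fun w => phi (X t w))).
Proof.
move=> t0 phiK.
have Pfin : (P setT < +oo)%E by rewrite probability_setT ltry.
apply: (@bounded_integrable _ _ _ _ _ _ K) => //.
apply: (@measurableT_comp _ _ _ _ _ _ phi) => //; exact: (hX.1 t t0).
Qed.

(** In [path_formula], each jump term has the expectation of an integral of the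
    intensity ([crossing_balance_signed]), and adding these integrals to the
    time derivative gives the drift, which is bounded below pathwise. *)
Lemma dynkin_ge (f g : R -> nat -> R) (M : nat) (e Kd K Kf : R) :
  (forall n t, 0 <= t <= T -> has_derivative (f^~ n) t (g t n)) ->
  (forall n t, 0 <= t <= T -> {for t, continuous (g^~ n)}) ->
  (forall n t, (M <= n)%N -> 0 <= t <= T -> f t n = 0) ->
  (forall n t, (M <= n)%N -> 0 <= t <= T -> g t n = 0) ->
  (forall n, `|f T n| <= Kf) ->
  (forall n t, 0 <= t <= T -> `|f t n.+1 - f t n| <= Kd) ->
  (forall n t, 0 <= t <= T -> 0 <= L t n) ->
  (forall n, measurable_fun `[0, T] (fun t => (f t n.+1 - f t n) * L t n)) ->
  (forall n t, 0 <= t <= T -> `|(f t n.+1 - f t n) * L t n| <= K) ->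
  (forall n t, 0 <= t <= T -> - e <= g t n + (f t n.+1 - f t n) * L t n) ->
  f 0 0%N - e * T <= Rintegral P setT (fun w => f T (X T w)).
Proof.
move=> df cg fM gM fK DK L0 mH HK drift.
have T0' := ltW T0.
have mI : measurable (`[0, T]%classic : set (measurableTypeR R)) by [].
have mO : measurable [set: Omega] by [].
pose D n t := f t n.+1 - f t n.
pose H n t := D n t * L t n.
pose Z n w := crossing_value X T n (D n) w - occupation_integral X T n (H n) w.
have cD n t : 0 <= t <= T -> {for t, continuous (D n)}.
  by move=> tT; apply: continuousB; exact: has_derivative_continuous (df _ _ tT).
have ZP n := crossing_balance_signed hX T0 hint (cD n) (DK n) (mH n) (L0 n) (HK n).
have [iS ES] : P.-integrable setT (EFin \o (fun w => \sum_(0 <= n < M) Z n w)) /\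
    Rintegral P setT (fun w => \sum_(0 <= n < M) Z n w) = 0.
  elim: M {fM gM} => [|M [ihi ihE]].
    have -> : (fun w => \sum_(0 <= n < 0) Z n w) = cst 0.
      by apply/funext => w; rewrite big_nil.
    split; last by rewrite Rintegral_cst// mul0r.
    by rewrite (_ : EFin \o _ = cst 0%E)//; exact: integrable0.
  have -> : (fun w => \sum_(0 <= n < M.+1) Z n w) =
      (fun w => \sum_(0 <= n < M) Z n w + Z M w).
    by apply/funext => w; rewrite big_nat_recr.
  have [iZ EZ] := ZP M.
  split; first exact: (integrableD mO ihi iZ).
  by rewrite RintegralD// ihE EZ addr0.
(* [Z n] has mean 0 and absorbs the difference between jumps and intensity *)
have path w : f 0 0%N - e * T + \sum_(0 <= n < M) Z n w <= f T (X T w).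
  have hx := path_counting hX w.
  have [ig ->] := path_formula hx T0' df cg fM gM.
  have iH n := integrable_occupation_path hX T0 n (mH n) (HK n) w.
  have [iSH ESH] := Rintegral_sum_nat M mI iH.
  have -> : \sum_(0 <= n < M) Z n w =
      \sum_(0 <= n < M) (n.+1 <= X T w)%:R *
        (f (event_time (X ^~ w) n.+1) n.+1 - f (event_time (X ^~ w) n.+1) n)
      - \sum_(0 <= n < M) occupation_integral X T n (H n) w.
    by rewrite -sumrB.
  rewrite /occupation_integral -ESH.
  suff h : - (e * T) <= Rintegral mu `[0, T] (fun t => g t (X t w)) +
      Rintegral mu `[0, T] (fun t => \sum_(0 <= n < M) (X t w == n)%:R * H n t).
    exact: drift_arith.
  rewrite -RintegralD// -mulNr -(Rintegral_cst_itv0 _ T0').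
  apply: le_Rintegral => //.
  - apply: (@bounded_integrable _ _ _ _ _ _ `|- e|) => //.
    exact: lebesgue_itv0_lty.
  - exact: (integrableD mI ig iSH).
  move=> t; rewrite /= in_itv/= => tT.
  have [XM|XM] := ltnP (X t w) M.
    rewrite (bigD1_seq (X t w)) ?iota_uniq ?mem_index_iota//= eqxx mul1r.
    rewrite big1 ?addr0; first exact: drift.
    by move=> n nX; rewrite eq_sym (negbTE nX) mul0r.
  rewrite big1_seq ?addr0.
    have := drift (X t w) t tT.
    by rewrite !fM ?(leqW XM)// subrr mul0r addr0.
  move=> n; rewrite mem_index_iota => /andP[_ /andP[_ nM]].
  by rewrite gtn_eqF ?mul0r// (leq_trans nM XM).
have iF := integrable_count_fun T0' fK.
have Pfin : (P setT < +oo)%E by rewrite probability_setT ltry.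
have Pc : Rintegral P setT (fun=> f 0 0%N - e * T) = f 0 0%N - e * T.
  have P1 : fine (P setT) = 1 by rewrite probability_setT.
  by rewrite Rintegral_cst// -[RHS]mulr1; congr (_ * _); exact: P1.
have ic : P.-integrable setT (EFin \o (fun=> f 0 0%N - e * T)).
  apply: (@bounded_integrable _ _ _ _ _ _ `|f 0 0%N - e * T|) => //.
apply: (@le_trans _ _ (Rintegral P setT
    (fun w => f 0 0%N - e * T + \sum_(0 <= n < M) Z n w))).
  by rewrite RintegralD// Pc ES addr0.
apply: le_Rintegral => //; exact: (integrableD mO ic iS).
Qed.

End DynkinInequality.

(** * The intensity near the origin *)

Section IntensityExpansion.
Context {R : realType}.

Lemma derivative_expansion (f : R -> R) (eta : R) : derivable f 0 1 -> 0 < eta ->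
  \forall z \near (0 : R), `|f z - f 0 - derive1 f 0 * z| <= eta * `|z|.
Proof.
move=> df e0.
have l : h^-1 *: (f (h *: (1 : R) + 0) - f 0) @[h --> (0 : R)^'] --> derive1 f 0.
  by rewrite derive1E; exact: df.
have {l} := (@cvgrPdist_le _ _ _ _ _ _ _).1 l _ e0.
rewrite near_withinE => h; near=> z.
have [->|z0] := eqVneq z 0; first by rewrite mulr0 !subrr normr0 mulr0.
have hz : z != 0 -> `|derive1 f 0 - z^-1 *: (f (z *: (1 : R) + 0) - f 0)| <= eta.
  by near: z; exact: h.
have := hz z0; rewrite /GRing.scale/= mulr1 addr0 => hz'.
rewrite -normrN opprB.
have -> : derive1 f 0 * z - (f z - f 0) = (derive1 f 0 - z^-1 * (f z - f 0)) * z.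
  by rewrite mulrBl mulrAC mulVf// mul1r.
by rewrite normrM ler_wpM2r.
Unshelve. all: by end_near.
Qed.

(** The expansion comes from the derivative at 0, and the continuity from the
    differentiability around 0; the latter serves in [intensity_meas]. *)
Lemma psi_neighbourhood (psi : R -> R) (eta : R) : C1_at0 psi -> 0 < eta ->
  exists2 rho : R, 0 < rho & forall z, `|z| < rho ->
    `|psi z - psi 0 - derive1 psi 0 * z| <= eta * `|z| /\ {for z, continuous psi}.
Proof.
move=> [dpsi _] e0.
have d0 : derivable psi 0 1 := nbhs_singleton dpsi.
have [rho /= r0 hr] := filterI (derivative_expansion d0 e0) dpsi.
exists rho => // z zr.
have [//|h1 h2] := hr z; first by rewrite /= sub0r normrN.
split => //; move: h2.
by rewrite derivable1_diffP => /differentiable_continuous.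
Qed.

End IntensityExpansion.

Section OneSidedLimit.
Context {R : realType} {d : measure_display} {Omega : measurableType d}.
Context (X : R -> Omega -> nat) (P : R -> R -> probability Omega R)
  (S : R) (psi : R -> R).

Definition normalized (T : R) (n : nat) : R := (n%:R - S * T) / Num.sqrt (S * T).

(** [psi] may fail to be measurable away from 0, but the factor [D] vanishes
    there. *)
Lemma intensity_meas (rho theta v T : R) (D : R -> R) : 0 < T ->
  (forall z, `|z| < rho -> {for z, continuous psi}) ->
  (forall t, 0 <= t <= T -> {for t, continuous D}) ->
  (forall t, 0 <= t <= T -> rho <= `|theta * (S * t - v)| -> D t = 0) ->
  measurable_fun `[0, T] (fun t => D t * (S * psi (theta * (S * t - v)))).
Proof.
move=> T0 cpsi cD Dfar.
have mpsi : measurable_fun setT (psi \_ `]- rho, rho[).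
  apply/(measurable_restrictT _ _).1 => //.
  apply: open_continuous_measurable_fun => // z; rewrite inE/= in_itv/= -ltr_norml.
  exact: cpsi.
apply: (eq_measurable_fun (fun t => D t * (S * (psi \_ `]- rho, rho[) (theta * (S * t - v))))).
  move=> t; rewrite inE/= in_itv/= => tT; rewrite patchE.
  case: ifPn => //; rewrite notin_setE/= in_itv/= -ltr_norml => /negP.
  by rewrite -leNgt => /(Dfar t tT) ->; rewrite !mul0r.
apply: measurable_funM.
  apply: subspace_continuous_measurable_fun => //.
  by apply: continuous_in_subspaceT => t; rewrite inE/= in_itv/=; exact: cD.
apply: measurable_funM => //; apply: measurable_funTS.
apply: (measurableT_comp mpsi); apply: measurable_funM => //.
by apply: measurable_funB => //; apply: measurable_funM.
Qed.

End OneSidedLimit.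

(** * One-sided limits of smooth functionals *)

Lemma scale_exists {R : realType} (S h0 : R) : 0 < S -> 0 < h0 ->
  exists2 T0 : R, 0 < T0 & forall T, T0 < T ->
    0 < (Num.sqrt (S * T))^-1 /\ (Num.sqrt (S * T))^-1 <= h0.
Proof.
move=> S0 h00; exists ((h0 ^+ 2)^-1 / S).
  by rewrite divr_gt0// invr_gt0 exprn_gt0.
move=> T hT.
have ST : (h0 ^+ 2)^-1 < S * T by rewrite mulrC -ltr_pdivrMr.
have ST0 : 0 < S * T by apply: lt_trans ST; rewrite invr_gt0 exprn_gt0.
have s0 : 0 < Num.sqrt (S * T) by rewrite sqrtr_gt0.
split; first by rewrite invr_gt0.
rewrite -[leRHS]invrK lef_pV2 ?posrE ?invr_gt0//.
rewrite -[leLHS]ger0_norm ?invr_ge0 ?(ltW h00)// -sqrtr_sqr exprVn.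
by rewrite ler_sqrt ltW.
Qed.

(** The choice of constants: first [eta'], the precision of the expansion of
    [psi], then the support [a] of the cutoff, then the horizon, each making one
    third of the error in [ou_test_drift_ge] less than [eps / 3].  The cutoff is
    1 at the start and at most 1 at the end, so it disappears from the bound. *)
Lemma score_liminf {R : realType} {d : measure_display} {Omega : measurableType d}
    (X : R -> Omega -> nat) (P : R -> R -> probability Omega R)
    (S : R) (psi : R -> R) (u b c eps : R) (m q : R -> R) :
  counting_process X -> 0 < S -> (forall x, 0 < psi x) -> C1_at0 psi ->
  psi 0 = 1 -> 0 < derive1 psi 0 ->
  (forall T u : R, 0 < T -> 0 <= u ->
     has_intensity (P T u) X T (fun t w => intensity S psi T u t (X t w))) ->
  0 <= u -> 0 < b -> backward_pair u b m q -> 0 < eps ->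
  exists2 T0 : R, 0 < T0 & forall T, T0 < T ->
    gauss_cdf (- c / Num.sqrt (q 0)) - eps <=
    Rintegral (P T u) setT
      (fun w => gauss_cdf ((m 1 * normalized S T (X T w) - c) / Num.sqrt (q 1))).
Proof.
move=> hX S0 psi_gt0 psi_C1 psi0 dpsi0 hP u0 b0 mq eps0.
set p := derive1 psi 0 in dpsi0 *.
pose B := (Num.sqrt b)^-1.
have B0 : 0 <= B by rewrite invr_ge0 sqrtr_ge0.
pose K1 := 1 + `|c| * B.
have K10 : 0 < K1 by rewrite ltr_wpDr// mulr_ge0.
have u1 : 0 < u + 1 by rewrite ltr_wpDl.
(* [eta' <= p] keeps [eta <= u], the sign condition on the drift of the cutoff *)
pose eta' := Num.min p (eps * p / (3 * K1 * (u + 1))).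
have eta'0 : 0 < eta' by rewrite lt_min dpsi0 divr_gt0 ?mulr_gt0.
pose eta := eta' * (u / p).
have up0 : 0 <= u / p by rewrite divr_ge0// ltW.
have eta0 : 0 <= eta by rewrite mulr_ge0// ltW.
have eta_u : eta <= u.
  have : eta' <= p by rewrite ge_min lexx.
  move=> /(ler_wpM2r up0) h; apply: (le_trans h).
  by rewrite mulrCA divff ?gt_eqF// mulr1.
have etaK : eta * K1 <= eps / 3.
  have : eta' <= eps * p / (3 * K1 * (u + 1)) by rewrite ge_min lexx orbT.
  move=> /(ler_wpM2r up0)/(ler_wpM2r (ltW K10)) h; apply: (le_trans h).
  have -> : eps * p / (3 * K1 * (u + 1)) * (u / p) * K1 = eps / 3 * (u / (u + 1)).
    by field; rewrite !gt_eqF.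
  rewrite ler_piMr ?divr_ge0 ?(ltW eps0)// ler_pdivrMr// mul1r; lra.
have [rho rho0 hrho] := psi_neighbourhood psi_C1 eta'0.
pose a := Num.min (rho * p / (4 * (u + 1))) (eps / (6 * (u + 1) * (B ^+ 2 + 1))).
have B21 : 0 < B ^+ 2 + 1 by rewrite ltr_wpDl// sqr_ge0.
have a0 : 0 < a by rewrite lt_min !divr_gt0 ?mulr_gt0.
have a_rho : u / p * (2 * a) < rho.
  have ha : a <= rho * p / (4 * (u + 1)) by rewrite ge_min lexx.
  have h2 : 2 * a <= 2 * (rho * p / (4 * (u + 1))) by rewrite ler_wpM2l.
  apply: (le_lt_trans (ler_wpM2l up0 h2)).
  have -> : u / p * (2 * (rho * p / (4 * (u + 1)))) = rho * (u / (2 * (u + 1))).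
    by field; rewrite !gt_eqF.
  by rewrite gtr_pMr// ltr_pdivrMr ?mulr_gt0//; lra.
have a_eps : 2 * u * a * B ^+ 2 <= eps / 3.
  have ha : a <= eps / (6 * (u + 1) * (B ^+ 2 + 1)) by rewrite ge_min lexx orbT.
  have w0 : 0 <= 2 * u * B ^+ 2 by rewrite !mulr_ge0// sqr_ge0.
  have -> : 2 * u * a * B ^+ 2 = 2 * u * B ^+ 2 * a by ring.
  apply: (le_trans (ler_wpM2l w0 ha)).
  have -> : 2 * u * B ^+ 2 * (eps / (6 * (u + 1) * (B ^+ 2 + 1))) =
    eps / 3 * ((u / (u + 1)) * (B ^+ 2 / (B ^+ 2 + 1))).
    by field; rewrite !gt_eqF.
  rewrite ler_piMr ?divr_ge0 ?(ltW eps0)//.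
  rewrite mulr_ile1 ?divr_ge0 ?sqr_ge0// ?(ltW u1) ?(ltW B21)//.
    by rewrite ler_pdivrMr// mul1r; lra.
  by rewrite ler_pdivrMr// mul1r; lra.
clearbody a.
pose K3 := (1 + 4 * u * a) * (2 * B ^+ 3 + 27 / a ^+ 2 + B * (8 / a + 27 / a ^+ 2)).
have K30 : 0 <= K3.
  have B3 := exprn_ge0 3 B0; have a0' := ltW a0.
  rewrite mulr_ge0//; first by rewrite addr_ge0// !mulr_ge0.
  rewrite addr_ge0//; last by rewrite mulr_ge0// addr_ge0// divr_ge0// sqr_ge0.
  by rewrite addr_ge0 ?mulr_ge0// invr_ge0 sqr_ge0.
pose h0 := Num.min 1 (Num.min a (eps / (3 * (K3 + 1)))).
have K31 : 0 < K3 + 1 by rewrite ltr_wpDl.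
have h00 : 0 < h0 by rewrite !lt_min ltr01 a0 divr_gt0 ?mulr_gt0.
have [T0 T00 hT0] := scale_exists S0 h00.
exists T0 => // T TT.
have Tp : 0 < T := lt_trans T00 TT.
have [] := hT0 _ TT; set h := (Num.sqrt (S * T))^-1 => hp hh0.
have h1 : h <= 1 by apply: le_trans hh0 _; rewrite ge_min lexx.
have ha : h <= a by apply: le_trans hh0 _; rewrite !ge_min lexx orbT.
have hK : h * K3 <= eps / 3.
  have : h <= eps / (3 * (K3 + 1)).
    by apply: le_trans hh0 _; rewrite !ge_min lexx !orbT.
  move=> /(ler_wpM2r K30) hk; apply: (le_trans hk).
  have -> : eps / (3 * (K3 + 1)) * K3 = eps / 3 * (K3 / (K3 + 1)).
    by field; rewrite gt_eqF.
  rewrite ler_piMr ?divr_ge0 ?(ltW eps0)// ler_pdivrMr// mul1r; lra.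
have h2a : h ^+ 2 <= a by apply: le_trans ha; rewrite expr2 ler_piMl// ltW.
have ST0 : 0 < S * T by rewrite mulr_gt0.
have h2E : h ^+ 2 = (S * T)^-1 by rewrite exprVn sqr_sqrtr// ltW.
have hn0 : h != 0 by rewrite gt_eqF.
have Sn0 : S != 0 by rewrite gt_eqF.
have Tn0 : T != 0 by rewrite gt_eqF.
have pn0 : p != 0 by rewrite gt_eqF.
pose v (n : nat) : R := n%:R / (S * T).
have vS n : v n.+1 = v n + h ^+ 2 by rewrite /v h2E -natr1 mulrDl mul1r.
pose f (t : R) n := ou_test m q c h a (v n) (t / T).
pose g (t : R) n := ou_test_slope m q u c h a (v n) (t / T) / T.
pose L t n := intensity S psi T u t n.
have s01 t : 0 <= t <= T -> 0 <= t / T <= 1.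
  by move=> /andP[t0 tT]; rewrite divr_ge0 ?(ltW Tp)//= ler_pdivrMr// mul1r.
pose z t (n : nat) := theta S psi T u * (S * t - n%:R).
have zE t n : z t n = - (u / p) * (v n - t / T).
  by rewrite /z /theta -/p /v; field; rewrite Sn0 Tn0 pn0.
have znorm t n : `|z t n| = u / p * `|v n - t / T|.
  by rewrite zE normrM normrN (ger0_norm up0).
have psiE t n : `|v n - t / T| <= 2 * a ->
    `|psi (z t n) - 1 + u * (v n - t / T)| <= eta * `|v n - t / T|.
  move=> xa; have zr : `|z t n| < rho.
    by rewrite znorm; apply: le_lt_trans a_rho; exact: ler_wpM2l.
  have [+ _] := hrho _ zr; rewrite psi0 -/p znorm mulrA -/eta.
  suff -> : p * z t n = - (u * (v n - t / T)) by rewrite opprK.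
  by rewrite zE mulNr mulrN mulrA (mulrCA p) divff// mulr1.
have far t n : 2 * a < `|v n - t / T| -> f t n = 0 /\ f t n.+1 = 0.
  move=> xa; split; apply: ou_test_far => //.
    by apply: le_trans (ltW xa); rewrite ler_peMl ?(ltW a0)// ler1n.
  have h20 : 0 <= h ^+ 2 := sqr_ge0 h.
  rewrite vS; have := ler_normB (v n + h ^+ 2 - t / T) (h ^+ 2).
  rewrite (ger0_norm h20) (_ : v n + h ^+ 2 - t / T - h ^+ 2 = v n - t / T); last by ring.
  by move: xa h2a; clear; lra.
(* the state never exceeds [(1 + a) N] within the support of the cutoff *)
have [M hM] : exists M : nat, (1 + a) * (S * T) <= M%:R.
  exists (Num.bound ((1 + a) * (S * T))); apply: ltW.
  by apply: archi_boundP; rewrite mulr_ge0 ?addr_ge0// ltW.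
have farM t n : (M <= n)%N -> 0 <= t <= T -> a <= `|v n - t / T|.
  move=> Mn /s01/andP[_ t1].
  have vn : 1 + a <= v n.
    by rewrite /v ler_pdivlMr// (le_trans hM)// ler_nat.
  by apply: le_trans (ler_norm _); move: vn t1; clear; lra.
have inv_der (t : R) : has_derivative (fun t => t / T) t T^-1.
  apply: (has_derivative_ext _ (has_derivative_affine T^-1 0 t)) => r.
  by rewrite addr0 mulrC.
have df n t : 0 <= t <= T -> has_derivative (f^~ n) t (g t n).
  move=> /s01 st; apply: has_derivative_comp (inv_der t).
  exact: (has_derivative_ou_test b0 mq c hp a0 (v n) st).
have fb t n : 0 <= f t n <= 1 by exact: ou_test_bounds.
have D1 t n : `|f t n.+1 - f t n| <= 1.
  have /andP[f0 f1] := fb t n; have /andP[f2 f3] := fb t n.+1.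
  move: f0 f1 f2 f3; clear => *.
  by rewrite ler_norml; apply/andP; split; lra.
have cD n t : 0 <= t <= T -> {for t, continuous (fun t => f t n.+1 - f t n)}.
  move=> tT; apply: continuousB; exact: has_derivative_continuous (df _ _ tT).
have Hd : forall n t, 0 <= t <= T ->
    - ((eta * K1 + 2 * u * a * B ^+ 2 + h * K3) / T) <=
    g t n + (f t n.+1 - f t n) * L t n.
  move=> n t tT.
  have := @ou_test_drift_ge _ u b m q b0 mq c h a hp a0 (v n) (t / T) (psi (z t n))
    eta B (s01 _ tT).
  rewrite eta0 eta_u => /(_ isT h1 h2a (ltW (psi_gt0 _)) (@psiE t n) erefl).
  rewrite -/K1 -/K3 -vS => H.
  have -> : g t n + (f t n.+1 - f t n) * L t n =
    (ou_test_slope m q u c h a (v n) (t / T) + h ^- 2 *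
      (psi (z t n) * (ou_test m q c h a (v n.+1) (t / T) -
         ou_test m q c h a (v n) (t / T)))) / T.
    rewrite -exprVn invrK sqr_sqrtr ?(ltW ST0)//.
    by rewrite /L /intensity -/(z t n) /g /f; field.
  by rewrite -mulNr ler_pM2r ?invr_gt0.
have L0 n t : 0 <= t <= T -> 0 <= L t n.
  by move=> _; rewrite /L /intensity mulr_ge0 ?(ltW S0)// ltW.
have mH n : measurable_fun `[0, T] (fun t => (f t n.+1 - f t n) * L t n).
  apply: (@intensity_meas _ S psi rho) => //.
  - by move=> y yr; have [] := hrho y yr.
  - exact: cD.
  move=> t tT; rewrite -/(z t n) znorm => zr.
  have [|-> ->] := far t n; last by rewrite subrr.
  rewrite ltNge; apply/negP => xa.
  by have := le_lt_trans (le_trans zr (ler_wpM2l up0 xa)) a_rho; rewrite ltxx.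
have HK n t : 0 <= t <= T -> `|(f t n.+1 - f t n) * L t n| <= 1 * (S * (1 + 4 * u * a)).
  move=> tT; have [xa|xa] := leP `|v n - t / T| (2 * a); last first.
    have [-> ->] := far t n xa; rewrite subrr mul0r normr0.
    by rewrite mul1r mulr_ge0 ?(ltW S0)// addr_ge0// !mulr_ge0// ltW.
  apply: normM_le; first exact: D1.
  rewrite ger0_norm ?L0// /L /intensity ler_pM2l// -/(z t n).
  have H := psiE t n xa.
  have e1 := ler_norm (psi (z t n) - 1 + u * (v n - t / T)).
  have e2 := ler_norm (- (u * (v n - t / T))).
  rewrite normrN normrM (ger0_norm u0) in e2.
  have e3 := ler_wpM2r (normr_ge0 (v n - t / T)) eta_u.
  have e4 := ler_wpM2l u0 xa.
  by move: H e1 e2 e3 e4; clear; lra.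
have cg n t : 0 <= t <= T -> {for t, continuous (g^~ n)}.
  move=> tT; apply: continuousM; last exact: cvg_cst.
  have cs := @continuous_ou_test_slope _ u b m q b0 mq c h a hp a0 (v n) _ (s01 _ tT).
  exact: (continuous_comp (has_derivative_continuous (inv_der t)) cs).
have fM n t : (M <= n)%N -> 0 <= t <= T -> f t n = 0.
  by move=> Mn tT; apply: ou_test_far => //; exact: farM.
have gM n t : (M <= n)%N -> 0 <= t <= T -> g t n = 0.
  by move=> Mn tT; rewrite /g ou_test_slope_far ?mul0r//; exact: farM.
have fK n : `|f T n| <= 1.
  by have /andP[f0 f1] := fb T n; rewrite ger0_norm.
have dyn := dynkin_ge hX Tp (hP T u Tp u0) df cg fM gM fK
  (fun n t _ => D1 t n) L0 mH HK Hd.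
have f00 : f 0 0%N = gauss_cdf (- c / Num.sqrt (q 0)).
  by rewrite /f /ou_test /ou_score /v !mul0r subrr cutoff0 mulr1 mul0r mulr0 sub0r.
have gb (y : R) : `|gauss_cdf y| <= 1 by rewrite ger0_norm ?gauss_cdf_ge0 ?gauss_cdf_le1.
apply: le_trans (le_trans dyn _).
  by rewrite f00 lerD2l lerN2 divfK//; move: etaK a_eps hK; clear; lra.
apply: le_Rintegral => //.
- exact: (integrable_count_fun (P T u) hX (ltW Tp) fK).
- exact: (integrable_count_fun (phi := fun n => gauss_cdf ((m 1 * normalized S T n - c) / Num.sqrt (q 1))) (P T u) hX (ltW Tp) (fun n => gb _)).
move=> w _; rewrite /f /ou_test divff// .
have -> : ou_score m q c h 1 (v (X T w) - 1) =
    (m 1 * normalized S T (X T w) - c) / Num.sqrt (q 1).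
  rewrite /ou_score /normalized; congr ((_ * _ - _) / _).
  have sE : S * T = h ^- 2 by rewrite h2E invrK.
  rewrite -/h /v invrK.
  have -> : Num.sqrt (S * T) = h^-1 by rewrite invrK.
  by rewrite sE; field.
by rewrite ler_piMr ?gauss_cdf_ge0// cutoff_le1.
Qed.

(** * Variance of the limit and choice of the smoothing *)

Section OrnsteinUhlenbeckVariance.
Context {R : realType}.
Implicit Types u s b e : R.

(** Variance at time [s] of the solution of [dY = - u Y dt + dW], [Y 0 = 0]. *)
Definition ou_var u s : R :=
  if u == 0 then s else (1 - expR (- (2 * u * s))) / (2 * u).

Definition ou_flow u e s : R := e * expR (- (u * (1 - s))).

Lemma ou_var_ge0 u s : 0 <= u -> 0 <= s -> 0 <= ou_var u s.
Proof.
move=> u0 s0; rewrite /ou_var; case: eqVneq => // un0.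
rewrite divr_ge0 ?mulr_ge0// subr_ge0 -[leRHS]expR0 ler_expR oppr_le0.
by rewrite !mulr_ge0.
Qed.

Lemma ou_var1_gt0 u : 0 <= u -> 0 < ou_var u 1.
Proof.
move=> u0; rewrite /ou_var; case: eqVneq => // un0.
have up : 0 < u by rewrite lt_neqAle eq_sym un0.
rewrite divr_gt0 ?mulr_gt0// subr_gt0 -[ltRHS]expR0 ltr_expR oppr_lt0.
by rewrite !mulr_gt0.
Qed.

(** With [e = 1] the test function is a smoothed indicator of [Y > c], with
    [e = - 1] one of [- Y > c]. *)
Lemma ou_backward_pair u b e : 0 <= u -> e ^+ 2 = 1 ->
  backward_pair u b (ou_flow u e) (fun s => b + ou_var u (1 - s)).
Proof.
move=> u0 e2 s /andP[s0 s1].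
have aff (k : R) : has_derivative (fun t : R => - (k * (1 - t))) s k.
  by apply: (has_derivative_ext _ (has_derivative_affine k (- k) s)) => t; ring.
have dexp (k : R) : has_derivative (fun t : R => expR (- (k * (1 - t)))) s
    (expR (- (k * (1 - s))) * k).
  exact: (has_derivative_comp (is_derive_expR _) (aff k)).
split.
- apply: (has_derivative_eq (has_derivative_mul (has_derivative_cst e s) (dexp u))).
  by rewrite /ou_flow; ring.
- rewrite /ou_flow exprMn e2 mul1r -expRM_natl mulrN mulrA /ou_var.
  case: eqVneq => [->|un0].
    rewrite mulr0 mul0r oppr0 expR0.
    by apply: (has_derivative_ext _ (has_derivative_affine (-1) (b + 1) s)) => t; ring.
  have d2 := has_derivative_mul (has_derivative_sub (has_derivative_cst 1 s)
    (dexp (2 * u))) (has_derivative_cst (2 * u)^-1 s).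
  apply: (has_derivative_eq (has_derivative_add (has_derivative_cst b s) d2)).
  by field.
- by rewrite lerDl ou_var_ge0// subr_ge0.
- rewrite /ou_flow normrM [`|expR _|]ger0_norm ?expR_ge0//.
  have -> : `|e| = 1.
    by apply/eqP; rewrite -(@eqrXn2 _ 2)// -normrX e2 normr1 expr1n.
  rewrite mul1r -[leRHS]expR0 ler_expR oppr_le0 mulr_ge0// subr_ge0//.
Qed.

(** The smoothing width [b = eta ^+ 4] is negligible with respect to the shift
    [eta]. *)
Lemma smoothing_choice (c sigma2 delta : R) : 0 < sigma2 -> 0 < delta ->
  exists eta : R, [/\ 0 < eta,
    gauss_cdf (- c / Num.sqrt sigma2) - delta <=
      gauss_cdf (- (c + eta) / Num.sqrt (eta ^+ 4 + sigma2)) &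
    gauss_cdf (- eta / Num.sqrt (eta ^+ 4)) <= delta].
Proof.
move=> s0 d0.
have c1 : {for (0 : R), continuous
    (fun eta : R => gauss_cdf (- (c + eta) / Num.sqrt (eta ^+ 4 + sigma2)))}.
  apply: (@continuous_comp _ _ _ (fun eta : R => - (c + eta) / Num.sqrt (eta ^+ 4 + sigma2)) gauss_cdf);
    last exact: continuous_gauss_cdf.
  apply: cvgM.
    by apply: cvgN; apply: cvgD; [exact: cvg_cst|exact: cvg_id].
  have s0' : 0 < (fun eta : R => eta ^+ 4 + sigma2) 0 by rewrite expr0n/= add0r.
  have sq := has_derivative_mul (has_derivative_id (0 : R)) (has_derivative_id 0).
  have qu : has_derivative (fun eta : R => eta ^+ 4 + sigma2) 0 0.
    apply: (has_derivative_ext _ (has_derivative_eq (has_derivative_add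
      (has_derivative_mul sq sq) (has_derivative_cst sigma2 0)) _)) => [t|]; ring.
  have hc := has_derivative_continuous (@has_derivative_inv_sqrt _
    (fun eta : R => eta ^+ 4 + sigma2) 0 0 s0' qu).
  exact: hc.
have n1 : \forall eta \near (0 : R), `|gauss_cdf (- c / Num.sqrt sigma2) -
    gauss_cdf (- (c + eta) / Num.sqrt (eta ^+ 4 + sigma2))| <= delta.
  have := (@cvgrPdist_le _ _ _ _ _ _ _).1 c1 _ d0.
  have z4 : 0 ^+ 4 = 0 :> R by rewrite expr0n.
  by rewrite z4 addr0 add0r; apply.
have n2 : \forall eta \near (0 : R)^'+, gauss_cdf (- eta^-1) <= delta.
  have lim : gauss_cdf (- eta^-1) @[eta --> (0 : R)^'+] --> (0 : R).
    apply: (@cvg_comp _ _ _ (fun eta : R => - eta^-1) gauss_cdf _ -oo); last exact: gauss_cdf_cvgNy.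
    have inv_y : eta^-1 @[eta --> (0 : R)^'+] --> +oo.
      apply: (iffRL (@cvgrVy _ _ _ _ (@id R) _)); first exact: nbhs_right_gt.
      by apply: cvg_at_right_filter; exact: cvg_id.
    exact: (iffRL (cvgNrNy _) inv_y).
  move/cvgrPdist_le : lim => /(_ _ d0) H.
  near=> eta; have : `|0 - gauss_cdf (- eta^-1)| <= delta by near: eta; exact: H.
  by rewrite sub0r normrN; apply: le_trans; exact: ler_norm.
have [eta [[h1 h2] e0]] : exists eta : R, (`|gauss_cdf (- c / Num.sqrt sigma2) -
    gauss_cdf (- (c + eta) / Num.sqrt (eta ^+ 4 + sigma2))| <= delta /\
    gauss_cdf (- eta^-1) <= delta) /\ 0 < eta.
  apply: (@filter_ex _ _ (at_right_proper_filter (0 : R))).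
  apply: filterI; last exact: nbhs_right_gt.
  by apply: filterI n2; apply: cvg_at_right_filter n1.
exists eta; split => //.
  by have := le_trans (ler_norm _) h1; lra.
have -> : Num.sqrt (eta ^+ 4) = eta ^+ 2.
  by rewrite (exprM eta 2 2) sqrtr_sqr ger0_norm// sqr_ge0.
by rewrite (_ : - eta / eta ^+ 2 = - eta^-1)//; field; rewrite gt_eqF.
Unshelve. all: by end_near.
Qed.

End OrnsteinUhlenbeckVariance.

(** * Tails of the normalized count *)

Lemma ou_var0 {R : realType} (u : R) : ou_var u 0 = 0.
Proof.
by rewrite /ou_var; case: eqVneq => // _; rewrite mulr0 oppr0 expR0 subrr mul0r.
Qed.

(** The smoothed indicator centred at [c + eta] is at most [delta / 3] when
    [e * Y <= c], hence below the indicator of [c < e * Y] up to that error. *)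
Lemma tail_liminf {R : realType} {d : measure_display} {Omega : measurableType d}
    (X : R -> Omega -> nat) (P : R -> R -> probability Omega R)
    (S : R) (psi : R -> R) (u c e delta : R) :
  counting_process X -> 0 < S -> (forall x, 0 < psi x) -> C1_at0 psi ->
  psi 0 = 1 -> 0 < derive1 psi 0 ->
  (forall T u : R, 0 < T -> 0 <= u ->
     has_intensity (P T u) X T (fun t w => intensity S psi T u t (X t w))) ->
  0 <= u -> e ^+ 2 = 1 -> 0 < delta ->
  exists2 T0 : R, 0 < T0 & forall T, T0 < T ->
    gauss_cdf (- c / Num.sqrt (ou_var u 1)) - delta <=
    fine (P T u [set w | c < e * normalized S T (X T w)]).
Proof.
move=> hX S0 psi_gt0 psi_C1 psi0 dpsi0 hP u0 e2 d0.
have d3 : 0 < delta / 3 by rewrite divr_gt0.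
have [eta [eta0 h1 h2]] := smoothing_choice c (ou_var1_gt0 u0) d3.
have b0 : 0 < eta ^+ 4 by rewrite exprn_gt0.
have mq := ou_backward_pair (eta ^+ 4) u0 e2.
have [T0 T00 hT] := score_liminf (c + eta) hX S0 psi_gt0 psi_C1 psi0 dpsi0 hP u0 b0 mq d3.
exists T0 => // T TT; have T0' := lt_trans T00 TT.
have := hT _ TT.
rewrite subr0 subrr ou_var0 addr0 {1}/ou_flow subrr mulr0 oppr0 expR0 mulr1.
set A := [set w | _] => hA.
have Pfin : (P T u setT < +oo)%E by rewrite probability_setT ltry.
have mA : measurable A.
  rewrite (_ : A = X T @^-1` [set n | c < e * normalized S T n])//.
  by apply: (measurable_count hX); exact: ltW.
have mO : measurable [set: Omega] by [].
have iA : (P T u).-integrable setT (EFin \o \1_A) by exact: integrable_indic.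
have ic : (P T u).-integrable setT (EFin \o (fun=> delta / 3)).
  by apply: (@bounded_integrable _ _ _ _ _ _ `|delta / 3|).
have iF : (P T u).-integrable setT (EFin \o (fun w =>
    gauss_cdf ((e * normalized S T (X T w) - (c + eta)) / Num.sqrt (eta ^+ 4)))).
  apply: (integrable_count_fun (K := 1) (phi := fun n =>
    gauss_cdf ((e * normalized S T n - (c + eta)) / Num.sqrt (eta ^+ 4))) (P T u) hX (ltW T0')).
  by move=> n; rewrite ger0_norm ?gauss_cdf_ge0 ?gauss_cdf_le1.
have eA : Rintegral (P T u) setT \1_A = fine (P T u A).
  by rewrite /Rintegral integral_indic// setIT.
have P1 : fine (P T u setT) = 1 by rewrite probability_setT.
have ec : Rintegral (P T u) setT (fun=> delta / 3) = delta / 3.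
  by rewrite Rintegral_cst// -[RHS]mulr1; congr (_ * _); exact: P1.
suff le : Rintegral (P T u) setT (fun w =>
    gauss_cdf ((e * normalized S T (X T w) - (c + eta)) / Num.sqrt (eta ^+ 4))) <=
    fine (P T u A) + delta / 3.
  move: (le_trans hA le) h1; rewrite [_ + ou_var _ _]addrC; clear; lra.
rewrite -eA -[X in _ <= _ + X]ec -RintegralD//.
apply: le_Rintegral => //; first exact: (integrableD mO iA ic).
move=> w _ /=.
have [wA|wA] := boolP (w \in A).
  by rewrite (le_trans (gauss_cdf_le1 _))// lerDl ltW.
rewrite add0r (le_trans _ h2)// le_gauss_cdf// ler_wpM2r ?invr_ge0 ?sqrtr_ge0//.
move: wA; rewrite notin_setE/A/= => /negP; rewrite -leNgt; clear; lra.
Qed.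

(** * Closed form of the score statistic *)

Section ScoreStatistic.
Context {R : realType}.
Local Notation mu := (@lebesgue_measure R).
Implicit Types (x : R -> nat) (S T t : R).

Lemma near_left_le_lt (e : nat -> R) (t : R) n :
  \forall s \near t^'-, forall k, (k < n)%N -> (e k <= s) = (e k < t).
Proof.
elim: n => [|n IH]; first exact: nearW.
have h : \forall s \near t^'-, (e n <= s) = (e n < t).
  have [et|te] := ltP (e n) t.
    near=> s; have -> // : e n <= s.
    by near: s; exact: nbhs_left_ge.
  near=> s; apply/negbTE; rewrite -ltNge; apply: lt_le_trans te.
  by near: s; exact: nbhs_left_lt.
near=> s => k; rewrite ltnS leq_eqVlt => /predU1P[->|kn].
  by near: s.
by move: k kn; near: s.
Unshelve. all: by end_near.
Qed.

Lemma sum_le_count (N j : nat) : (j <= N)%N ->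
  \sum_(1 <= k < N.+1) (k <= j)%:R = j%:R :> R.
Proof.
move=> jN; rewrite (big_cat_nat (n := j.+1))//=.
rewrite [X in _ + X]big1_seq ?addr0; last first.
  by move=> k; rewrite mem_index_iota => /andP[_ /andP[jk _]]; rewrite leqNgt jk.
rewrite (eq_big_seq (fun=> 1)); last first.
  by move=> k; rewrite mem_index_iota ltnS => /andP[_ ->].
by rewrite sumr_const_nat subn1.
Qed.

(** Close to [t] on the left, the events counted are those strictly before [t]. *)
Lemma left_valueE x t T : counting_path x -> 0 < t -> t <= T ->
  left_value x t = \sum_(1 <= k < (x T).+1) (event_time x k < t)%R%:R.
Proof.
move=> hx t0 tT; have T0 : 0 <= T := le_trans (ltW t0) tT.
apply: lim_near_cst; first exact: norm_hausdorff.
have n1 := near_left_le_lt (event_time x) t (x T).+1.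
near=> s; have s0 : 0 <= s by near: s; exact: nbhs_left_ge.
have st : s <= t by near: s; exact: nbhs_left_le.
have hs : forall k, (k < (x T).+1)%N -> (event_time x k <= s) = (event_time x k < t).
  by near: s.
rewrite -(@sum_le_count (x T)); last exact: counting_path_le hx s0 (le_trans st tT).
apply: eq_big_seq => k; rewrite mem_index_iota => /andP[_ kT].
by rewrite -hs// (event_time_leP hx s0 T0).
Unshelve. all: by end_near.
Qed.

Lemma left_value_event x k T : counting_path x -> 0 <= T -> (0 < k <= x T)%N ->
  left_value x (event_time x k) = k.-1%:R.
Proof.
move=> hx T0 kk; have /andP[k0 kT] := kk.
rewrite (left_valueE hx (event_time_gt0 hx T0 kk) (event_time_le T0 kT)).
rewrite -(@sum_le_count (x T) k.-1); last by rewrite (leq_trans (leq_pred _)).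
apply: eq_big_seq => j; rewrite mem_index_iota ltnS => /andP[j0 jT].
congr (nat_of_bool _)%:R; apply/idP/idP => h.
  have /(before_event _ hx T0 jT)/(before_at_event _ hx T0 kk) : event_time x j < event_time x k by [].
  by rewrite -{1}(prednK k0) ltnS.
apply/(before_event _ hx T0 jT)/(before_at_event _ hx T0 kk).
by rewrite -(prednK k0) ltnS.
Qed.

Lemma integrable_step (a T : R) : 0 <= T ->
  mu.-integrable `[0, T] (EFin \o (fun t => (a < t)%R%:R)).
Proof.
move=> T0; apply: (@bounded_integrable _ _ _ _ _ _ 1) => //.
- exact: lebesgue_itv0_lty.
- apply: (eq_measurable_fun (fun t : R => if a < t then 1 else 0 : R)).
    by move=> t _; case: (a < t).
  by apply: measurable_funTS; apply: measurable_fun_ifT => //; exact: measurable_fun_ltr.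
- by move=> t _; case: (_ < _); rewrite ?normr1 ?normr0.
Qed.

Lemma Rintegral_step (a T : R) : 0 <= a <= T ->
  Rintegral mu `[0, T] (fun t => (a < t)%R%:R) = T - a.
Proof.
move=> /andP[a0 aT].
transitivity (Rintegral mu `[0, T] ((fun=> 1 : R) \_ `]a, T])).
  apply: eq_Rintegral => t; rewrite inE/= in_itv/= => /andP[_ tT].
  by rewrite /= mem_setE in_itv/= tT andbT; case: (a < t).
rewrite -Rintegral_mkcondr.
have -> : `[0, T] `&` `]a, T] = `]a, T]%classic.
  apply/setIidr => t /=; rewrite !in_itv/= => /andP[at' ->].
  by rewrite (le_trans a0 (ltW at')).
rewrite Rintegral_cst// mul1r.
have := lebesgue_measure_itv (`]a, T]%R : interval R) => /= e.
suff e' : mu `]a, T]%classic = (T - a)%:E by have := congr1 fine e'.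
apply: (eq_trans e); rewrite lte_fin.
by move: aT; rewrite le_eqVlt => /predU1P[->|->]; rewrite ?ltxx ?subrr// EFinB.
Qed.

Lemma sum_pred_nat (N : nat) :
  \sum_(1 <= k < N.+1) k.-1%:R = N%:R * (N%:R - 1) / 2 :> R.
Proof.
elim: N => [|N IH]; first by rewrite big_nil !mul0r.
by rewrite big_nat_recr//= IH -natr1; field.
Qed.

(** Event [k] contributes [S * tau k - (k - 1)] to the jump part, and the
    compensator contains [\sum_k (T - tau k)]: the event times cancel. *)
Lemma score_statisticE x S T : counting_path x -> 0 < S -> 0 < T ->
  score_statistic S x T =
  ((x T)%:R - ((x T)%:R - S * T) ^+ 2) / (2 * (S * T)).
Proof.
move=> hx S0 T0; have T0' := ltW T0.
set N := x T; set A := \sum_(1 <= k < N.+1) event_time x k.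
have pE : path_integral x T (fun t => S * t - left_value x t) =
    S * A - N%:R * (N%:R - 1) / 2.
  rewrite /path_integral -sum_pred_nat mulr_sumr -sumrB.
  apply: eq_big_seq => k; rewrite mem_index_iota ltnS => kk.
  by rewrite (left_value_event hx T0' kk).
pose LV t := \sum_(1 <= k < N.+1) (event_time x k < t)%R%:R : R.
have mI : measurable (`[0, T]%classic : set (measurableTypeR R)) by [].
have eN k : (0 < k <= N)%N -> 0 <= event_time x k <= T.
  by move=> /andP[_ kN]; rewrite (@event_time_ge0 _ x _ _ T0' kN) (@event_time_le _ x _ _ T0' kN).
have [iLV ELV] := Rintegral_sum_nat N mI (fun n => integrable_step (event_time x n.+1) T0').
have LVE : LV = (fun t => \sum_(0 <= n < N) (event_time x n.+1 < t)%R%:R).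
  by apply/funext => t; rewrite /LV big_add1.
have eLV : Rintegral mu `[0, T] LV = N%:R * T - A.
  rewrite LVE ELV /A big_add1/=.
  rewrite (eq_big_seq (fun n => T - event_time x n.+1)); last first.
    by move=> n; rewrite mem_index_iota => nN; rewrite Rintegral_step// eN.
  by rewrite sumrB sumr_const_nat subn0 mulr_natl.
have dlin (t : R) : has_derivative (fun t => S / 2 * (t * t)) t (S * t).
  apply: (has_derivative_eq (has_derivative_mul (has_derivative_cst (S / 2) t)
    (has_derivative_mul (has_derivative_id t) (has_derivative_id t)))).
  by field.
have clin (t : R) : {for t, continuous (fun t : R => S * t)}.
  by apply: cvgM; [exact: cvg_cst|exact: cvg_id].
have ilin : mu.-integrable `[0, T] (EFin \o (fun t => S * t)).
  exact: continuous_integrable_itv (fun t _ => clin t).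
have elin : Rintegral mu `[0, T] (fun t => S * t) = S / 2 * (T * T).
  rewrite (Rintegral_derivative T0' (fun t _ => dlin t) (fun t _ => clin t)).
  by rewrite mulr0 mulr0 subr0.
have iB : mu.-integrable `[0, T] (EFin \o (fun t => S * t - LV t)).
  by rewrite LVE; exact: (integrableB mI ilin iLV).
have iLV' : mu.-integrable `[0, T] (EFin \o LV) by rewrite LVE.
have cE : Rintegral mu `[0, T] (fun t => S * t - left_value x t) =
    S / 2 * (T * T) - (N%:R * T - A).
  have oc : {in `]0, T]%classic, (fun t => S * t - LV t) =1
      (fun t => S * t - left_value x t)}.
    move=> t; rewrite inE/= in_itv/= => /andP[t0 tT].
    by rewrite (left_valueE hx t0 tT).
  have iBo : mu.-integrable `]0, T] (EFin \o (fun t => S * t - LV t)).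
    apply: integrableS iB => // t /=.
    by rewrite !in_itv/= => /andP[/ltW -> ->].
  have iCo : mu.-integrable `]0, T] (EFin \o (fun t => S * t - left_value x t)).
    by apply: (eq_integrable_real _ oc iBo).
  rewrite -(Rintegral_itv_obnd_cbnd iCo).
  rewrite -(eq_Rintegral mu oc) (Rintegral_itv_obnd_cbnd iBo).
  by rewrite RintegralB// elin eLV.
rewrite /score_statistic /centred_integral pE cE.
by field; rewrite !gt_eqF.
Qed.

End ScoreStatistic.

(** * Gaussian quantiles and elementary bounds on probabilities *)

Section GaussianQuantile.
Context {R : realType}.
Implicit Types a p r z : R.

Lemma normal_prob_tail z : normal_prob 0 1 `]z, +oo[ = (1 - gauss_cdf z)%:E.
Proof.
have -> : `]z, +oo[%classic = ~` `]-oo, z]%classic :> set R by rewrite setCitvl.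
by rewrite EFinB -gauss_cdfE; exact: probability_setC.
Qed.

Lemma gauss_cdf_onto p : 0 < p < 1 -> exists z, gauss_cdf z = p.
Proof.
move=> /andP[p0 p1].
have [a ha] : exists a, gauss_cdf a < p.
  have := gauss_cdf_cvgNy (R := R); move/cvgrPdist_lt => /(_ _ p0) h.
  have [a] := @filter_ex _ _ _ _ h.
  by rewrite sub0r normrN => h'; exists a; exact: le_lt_trans (ler_norm _) h'.
have [b hb] : exists b, p < gauss_cdf b.
  have p1' : 0 < 1 - p by rewrite subr_gt0.
  have := gauss_cdf_cvgy (R := R); move/cvgrPdist_lt => /(_ _ p1') h.
  have [b h'] := @filter_ex _ _ _ _ h; exists b.
  by have := le_lt_trans (ler_norm _) h'; lra.
have ab : a <= b.
  by rewrite leNgt; apply/negP => /ltW/le_gauss_cdf; lra.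
have [||z _ zE] := @IVT R gauss_cdf a b p ab; last by exists z.
- apply: derivable_within_continuous => z _.
  by case: (has_derivative_gauss_cdf z).
- by rewrite ge_min le_max (ltW ha) (ltW hb) orbT.
Qed.

(** The distribution function is a strictly increasing bijection onto ]0, 1[, so
    the infimum is over a closed half-line. *)
Lemma gauss_cdf_quantile a : 0 < a < 1 -> gauss_cdf (gauss_quantile a) = 1 - a.
Proof.
move=> /andP[a0 a1].
have [|z zE] := @gauss_cdf_onto (1 - a); first by apply/andP; split; lra.
suff -> : gauss_quantile a = z by [].
rewrite /gauss_quantile.
have -> : [set y : R | (normal_prob 0 1 `]y, +oo[ <= a%:E)%E] = `[z, +oo[%classic.
  apply/seteqP; split=> y /=; rewrite normal_prob_tail lee_fin in_itv/= andbT => h.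
    by rewrite leNgt; apply/negP => /lt_gauss_cdf; rewrite zE; lra.
  by have := le_gauss_cdf h; rewrite zE; lra.
by rewrite inf_itv.
Qed.

Lemma normal_prob_sym r : 0 <= r ->
  normal_prob 0 1 [set y : R | `|y| <= r] = (2 * gauss_cdf r - 1)%:E.
Proof.
move=> r0.
have null : normal_prob 0 1 [set - r] = 0%E.
  by rewrite /normal_prob integral_set1.
have -> : [set y : R | `|y| <= r] = [set - r] `|` (`]-oo, r] `\` `]-oo, - r]).
  apply/seteqP; split => y /=; rewrite ler_norml !in_itv/=.
    move=> /andP[h0 h'].
    have [->|yr] := eqVneq y (- r); [by left|right].
    have h : - r < y by rewrite lt_neqAle eq_sym yr.
    by split => //; apply/negP; rewrite -ltNge.
  move=> [->|[-> /negP]]; first by rewrite lexx (le_trans _ r0)// oppr_le0.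
  by rewrite -ltNge => /ltW ->.
have -> : (2 * gauss_cdf r - 1)%:E = (normal_prob 0 1 `]-oo, r] - normal_prob 0 1 `]-oo, (- r)%R])%E.
  by rewrite !gauss_cdfE gauss_cdfN -EFinB; congr (_%:E); ring.
rewrite measureU//=; [|exact: measurableD|].
  rewrite null add0e measureD//=; last by rewrite gauss_cdfE ltry.
  congr (_ - normal_prob 0 1 _)%E; apply/setIidr => y /=; rewrite !in_itv/=.
  by move=> /le_trans; apply; rewrite (le_trans _ r0)// oppr_le0.
apply/seteqP; split => y //= [->] [_]; rewrite in_itv/= lexx; exact.
Qed.

End GaussianQuantile.

Section ProbabilityBounds.
Context {R : realType} {d : measure_display} {Omega : measurableType d}.
Context (Q : probability Omega R).
Implicit Types A B C : set Omega.

Lemma fine_prob_le A B : measurable A -> measurable B -> A `<=` B ->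
  fine (Q A) <= fine (Q B).
Proof. by move=> mA mB AB; rewrite fine_le ?fin_num_measure// le_measure ?inE. Qed.

Lemma fine_prob_setC A : measurable A -> fine (Q (~` A)) = 1 - fine (Q A).
Proof. by move=> mA; rewrite probability_setC// fineB ?fin_num_measure. Qed.

Lemma fine_prob_setU A B : measurable A -> measurable B ->
  fine (Q (A `|` B)) <= fine (Q A) + fine (Q B).
Proof.
move=> mA mB; rewrite -fineD ?fin_num_measure// fine_le ?fin_num_measure//.
- exact: measurableU.
- by rewrite fin_numD !fin_num_measure.
- exact: measureU2.
Qed.

Lemma prob_ge_inter A B C : measurable A -> measurable B -> measurable C ->
  A `&` B `<=` C -> fine (Q A) + fine (Q B) - 1 <= fine (Q C).
Proof.
move=> mA mB mC ABC.
have mCA := measurableC mA; have mCB := measurableC mB; have mCC := measurableC mC.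
have sub : ~` C `<=` ~` A `|` ~` B.
  by rewrite -setCI; apply: subsetC.
have := le_trans (fine_prob_le mCC (measurableU _ _ mCA mCB) sub) (fine_prob_setU mCA mCB).
by rewrite !fine_prob_setC//; lra.
Qed.

Lemma prob_le_disjoint A B C : measurable A -> measurable B -> measurable C ->
  B `&` C = set0 -> A `<=` ~` (B `|` C) ->
  fine (Q A) <= 1 - fine (Q B) - fine (Q C).
Proof.
move=> mA mB mC BC sub; have mU := measurableU _ _ mB mC.
have := fine_prob_le mA (measurableC mU) sub.
rewrite fine_prob_setC// measureU// fineD ?fin_num_measure//; lra.
Qed.

End ProbabilityBounds.

(** * The limiting power *)

Section AcceptanceRegion.
Context {R : realType}.
Implicit Types S T z eta kappa y : R.

Definition accepted eps S T (n : nat) : bool :=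
  threshold eps < (n%:R - (n%:R - S * T) ^+ 2) / (2 * (S * T)).

(** Substituting [X_T = N + Y sqrt N] in [score_statisticE]; the correction
    [Y / sqrt N] comes from the term [X_T]. *)
Lemma acceptedE eps S T n : 0 < S * T ->
  accepted eps S T n = (normalized S T n ^+ 2 - (Num.sqrt (S * T))^-1 * normalized S T n
    < gauss_quantile ((1 - eps) / 2) ^+ 2).
Proof.
move=> N0; rewrite /accepted /threshold; set z := gauss_quantile _.
set y := normalized S T n; set r := Num.sqrt (S * T).
have r0 : 0 < r by rewrite sqrtr_gt0.
have r2 : S * T = r ^+ 2 by rewrite sqr_sqrtr// ltW.
have nE : n%:R = r ^+ 2 + y * r.
  by rewrite /y /normalized -/r r2 divfK ?gt_eqF//; ring.
have -> : (n%:R - (n%:R - S * T) ^+ 2) / (2 * (S * T)) =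
    (1 - (y ^+ 2 - r^-1 * y)) / 2.
  by rewrite r2 nE; field; rewrite gt_eqF.
by rewrite ltr_pM2r ?invr_gt0// ltrD2l ltrN2.
Qed.

Lemma inner_interval z eta kappa y : 0 < eta -> eta <= z -> 0 <= kappa <= eta ->
  `|y| < z - eta -> y ^+ 2 - kappa * y < z ^+ 2.
Proof.
move=> e0 ez /andP[k0 ke] yz; have y0 := normr_ge0 y.
have h1 := ler_norm (- y); rewrite normrN in h1.
have h2 : - (kappa * y) <= kappa * `|y| by rewrite -mulrN ler_wpM2l.
have h3 : kappa * `|y| <= eta * `|y| by rewrite ler_wpM2r.
rewrite -(real_normK (num_real y)); nra.
Qed.

Lemma outer_interval z eta kappa y : 0 < eta -> 0 <= z -> 0 <= kappa <= eta ->
  z + eta < `|y| -> z ^+ 2 <= y ^+ 2 - kappa * y.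
Proof.
move=> e0 z0 /andP[k0 ke] yz.
have h2 : kappa * y <= kappa * `|y| by rewrite ler_wpM2l// ler_norm.
have h3 : kappa * `|y| <= eta * `|y| by rewrite ler_wpM2r.
rewrite -(real_normK (num_real y)); nra.
Qed.

End AcceptanceRegion.

(** The acceptance region lies between [|Y| < z - eta] and [|Y| <= z + eta] for a
    large horizon.  Both probabilities are controlled by lower bounds on tails
    alone, the second one through its complement. *)
Lemma power_limit {R : realType} {d : measure_display} {Omega : measurableType d}
    (X : R -> Omega -> nat) (P : R -> R -> probability Omega R)
    (S : R) (psi : R -> R) (eps u : R) :
  counting_process X -> 0 < S -> (forall x, 0 < psi x) -> C1_at0 psi ->
  psi 0 = 1 -> 0 < derive1 psi 0 ->
  (forall T u : R, 0 < T -> 0 <= u ->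
     has_intensity (P T u) X T (fun t w => intensity S psi T u t (X t w))) ->
  0 <= u -> 0 < gauss_quantile ((1 - eps) / 2) ->
  fine (P T u [set w | accepted eps S T (X T w)]) @[T --> +oo] -->
    2 * gauss_cdf (gauss_quantile ((1 - eps) / 2) / Num.sqrt (ou_var u 1)) - 1.
Proof.
move=> hX S0 psi_gt0 psi_C1 psi0 dpsi0 hP u0.
set z := gauss_quantile _ => z0; set sigma := Num.sqrt _.
have cF : {for z, continuous (fun y : R => gauss_cdf (y / sigma))}.
  apply: (@continuous_comp _ _ _ (fun y : R => y / sigma) gauss_cdf);
    last exact: continuous_gauss_cdf.
  by apply: cvgM; [exact: cvg_id|exact: cvg_cst].
apply/cvgrPdist_le => delta delta0.
have d4 : 0 < delta / 4 by rewrite divr_gt0.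
have nF : \forall y \near z, `|gauss_cdf (z / sigma) - gauss_cdf (y / sigma)| <= delta / 4.
  by have := (@cvgrPdist_le _ _ _ _ _ _ _).1 cF _ d4; apply.
have [r /= r0 hr] := nF.
pose eta := Num.min z (r / 2).
have eta0 : 0 < eta by rewrite lt_min z0 divr_gt0.
have etaz : eta <= z by rewrite ge_min lexx.
have etar : eta < r.
  by have : eta <= r / 2 by [rewrite ge_min lexx orbT]; lra.
have Fm : `|gauss_cdf (z / sigma) - gauss_cdf ((z - eta) / sigma)| <= delta / 4.
  by apply: hr; rewrite /= opprB addrC subrK gtr0_norm.
have Fp : `|gauss_cdf (z / sigma) - gauss_cdf ((z + eta) / sigma)| <= delta / 4.
  by apply: hr; rewrite /= opprD addrA subrr sub0r normrN gtr0_norm.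
have tail c e := @tail_liminf _ _ _ X P S psi u c e (delta / 4)
  hX S0 psi_gt0 psi_C1 psi0 dpsi0 hP u0.
have sq1 : 1 ^+ 2 = 1 :> R by rewrite expr1n.
have sqN1 : (- 1) ^+ 2 = 1 :> R by rewrite sqrrN expr1n.
have [T1 T10 h1] := tail (- (z - eta)) 1 sq1 d4.
have [T2 T20 h2] := tail (- (z - eta)) (- 1) sqN1 d4.
have [T3 T30 h3] := tail (z + eta) 1 sq1 d4.
have [T4 T40 h4] := tail (z + eta) (- 1) sqN1 d4.
have [T5 T50 h5] := scale_exists S0 eta0.
near=> T.
have T1T : T1 < T by near: T; apply: nbhs_pinfty_gt; exact: num_real.
have T2T : T2 < T by near: T; apply: nbhs_pinfty_gt; exact: num_real.
have T3T : T3 < T by near: T; apply: nbhs_pinfty_gt; exact: num_real.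
have T4T : T4 < T by near: T; apply: nbhs_pinfty_gt; exact: num_real.
have T5T : T5 < T by near: T; apply: nbhs_pinfty_gt; exact: num_real.
have T0 : 0 < T := lt_trans T10 T1T.
have N0 : 0 < S * T by rewrite mulr_gt0.
have [k0 ke] := h5 _ T5T.
have kk : 0 <= (Num.sqrt (S * T))^-1 <= eta by rewrite (ltW k0).
have mX (phi : nat -> Prop) : measurable [set w | phi (X T w)].
  exact: (measurable_count hX phi (ltW T0)).
have := h1 _ T1T; have := h2 _ T2T; have := h3 _ T3T; have := h4 _ T4T.
rewrite -/sigma opprK mulNr gauss_cdfN.
set A := [set w | accepted _ _ _ _].
set C2 := [set w | z + eta < -1 * _]; set C1 := [set w | z + eta < 1 * _].
set B2 := [set w | _ < -1 * _]; set B1 := [set w | _ < 1 * _].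
have mA : measurable A := mX (fun n => accepted eps S T n).
have mC1 : measurable C1 := mX (fun n => z + eta < 1 * normalized S T n).
have mC2 : measurable C2 := mX (fun n => z + eta < -1 * normalized S T n).
have mB1 : measurable B1 := mX (fun n => - (z - eta) < 1 * normalized S T n).
have mB2 : measurable B2 := mX (fun n => - (z - eta) < -1 * normalized S T n).
move=> q4 q3 q2 q1.
have low : fine (P T u B1) + fine (P T u B2) - 1 <= fine (P T u A).
  apply: prob_ge_inter => // w [/= b1 b2].
  suff : accepted eps S T (X T w) by [].
  rewrite acceptedE//.
  apply: (inner_interval eta0 etaz kk).
  have b1' : - (z - eta) < 1 * normalized S T (X T w) := b1.
  have b2' : - (z - eta) < -1 * normalized S T (X T w) := b2.
  by move: b1' b2'; clear => *; rewrite ltr_norml; apply/andP; split; lra.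
have up : fine (P T u A) <= 1 - fine (P T u C1) - fine (P T u C2).
  apply: prob_le_disjoint => //.
    apply/seteqP; split => // w [c1 c2].
    have c1' : z + eta < 1 * normalized S T (X T w) := c1.
    have c2' : z + eta < -1 * normalized S T (X T w) := c2.
    by exfalso; move: c1' c2' eta0 z0; clear; lra.
  move=> w Aw c; have : accepted eps S T (X T w) := Aw.
  rewrite acceptedE//; apply/negP; rewrite -leNgt.
  apply: (outer_interval eta0 (ltW z0) kk).
  case: c => c.
    have c1 : z + eta < 1 * normalized S T (X T w) := c.
    by rewrite mul1r in c1; exact: lt_le_trans (ler_norm _).
  have c2 : z + eta < -1 * normalized S T (X T w) := c.
  by rewrite mulN1r in c2; rewrite -normrN; exact: lt_le_trans (ler_norm _).
move: Fm Fp; rewrite !ler_norml => /andP[m1 m2] /andP[p1 p2].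
move: q1 q2 q3 q4 low up m1 m2 p1 p2; clear => *.
apply/andP; split; lra.
Unshelve. all: by end_near.
Qed.

(** * The score function test *)

Section ScoreTest.
Context {R : realType} {d : measure_display} {Omega : measurableType d}.
Context (X : R -> Omega -> nat) (S eps : R) (hX : counting_process X) (S0 : 0 < S).

Lemma score_testE T : 0 < T ->
  score_test X S eps T = \1_[set w | accepted eps S T (X T w)].
Proof.
move=> T0; rewrite /score_test; congr (\1_ _); apply/seteqP; split=> w /=;
  by rewrite (score_statisticE (hX.2 w) S0 T0).
Qed.

Lemma score_test_function : test_function X (score_test X S eps).
Proof.
move=> T T0; split=> [w|B mB].
  by rewrite score_testE// indicE; case: (_ \in _); rewrite ?lexx ler01.
rewrite setTI score_testE//.
have -> : \1_[set w | accepted eps S T (X T w)] @^-1` B =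
    X T @^-1` [set n | B (accepted eps S T n)%:R].
  apply/seteqP; split=> w /=; rewrite indicE mem_setE; exact.
exact: filtration_event (ltW T0).
Qed.

Lemma expectation_score_test (Q : probability Omega R) T : 0 < T ->
  ('E_Q[score_test X S eps T])%E = (fine (Q [set w | accepted eps S T (X T w)]))%:E.
Proof.
move=> T0.
have mA : measurable [set w | accepted eps S T (X T w)].
  exact: (measurable_count hX (fun n => accepted eps S T n) (ltW T0)).
by rewrite score_testE// unlock integral_indic// setIT fineK// fin_num_measure.
Qed.

End ScoreTest.

Unset Implicit Arguments.
Set Strict Implicit.
Set Printing Implicit Defensive.

Theorem theorem1 (R : realType) (d : measure_display) (Omega : measurableType d)
    (X : R -> Omega -> nat) (P : R -> R -> probability Omega R)
    (S : R) (psi : R -> R) (eps : R)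
    (hX : counting_process X)
    (hS : 0 < S)
    (psi_gt0 : forall x, 0 < psi x)
    (psi_C1 : C1_at0 psi)
    (psi0 : psi 0 = 1)
    (dpsi0 : 0 < derive1 psi 0)
    (hP : forall T u : R, 0 < T -> 0 <= u ->
       has_intensity (P T u) X T (fun t w => intensity S psi T u t (X t w)))
    (heps : 0 < eps < 1) :
  asymptotic_size_class X P eps (score_test X S eps) /\
  forall u : R, 0 < u ->
    ('E_(P T u)[score_test X S eps T])%E @[T --> +oo] -->
      normal_prob 0 1
        [set x : R | `|x| <= hfun u * gauss_quantile ((1 - eps) / 2)].
Proof.
have /andP[eps0 eps1] := heps.
set a := (1 - eps) / 2.
have a01 : 0 < a < 1 by apply/andP; rewrite /a; split; lra.
have qE : gauss_cdf (gauss_quantile a) = 1 - a := gauss_cdf_quantile a01.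
have half : gauss_cdf (0 : R) = 1 / 2 by have := gauss_cdfN (0 : R); rewrite oppr0; lra.
have z0 : 0 < gauss_quantile a.
  rewrite ltNge; apply/negP => /le_gauss_cdf; rewrite qE half /a; lra.
have lim u : 0 <= u -> ('E_(P T u)[score_test X S eps T])%E @[T --> +oo] -->
    (2 * gauss_cdf (gauss_quantile a / Num.sqrt (ou_var u 1)) - 1)%:E.
  move=> u0; have l := power_limit hX hS psi_gt0 psi_C1 psi0 dpsi0 hP u0 z0.
  have e : \forall T \near +oo, (fine (P T u [set w | accepted eps S T (X T w)]))%:E =
      ('E_(P T u)[score_test X S eps T])%E.
    have n0 : \forall T \near +oo, (0 : R) < T.
      by apply: nbhs_pinfty_gt; exact: num_real.
    by apply: filterS n0 => T T0; rewrite (expectation_score_test eps hX hS).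
  apply: cvg_trans (near_eq_cvg e) _.
  by apply: cvg_comp l _.
split.
  split; first exact: score_test_function.
  have := lim 0 (lexx 0); rewrite {1}/ou_var eqxx sqrtr1 divr1 qE.
  by rewrite (_ : 2 * (1 - a) - 1 = eps)// /a; field.
move=> u u0.
have hE : gauss_quantile a / Num.sqrt (ou_var u 1) = hfun u * gauss_quantile a.
  rewrite mulrC /ou_var gt_eqF// mulr1 /hfun; congr (_ * _).
  have v0 : 0 <= (1 - expR (- (2 * u))) / (2 * u).
    by have := ltW (ou_var1_gt0 (ltW u0)); rewrite /ou_var gt_eqF// mulr1.
  by rewrite -sqrtrV// invf_div.
rewrite normal_prob_sym; last by rewrite mulr_ge0 ?sqrtr_ge0// ltW.
by rewrite -hE; exact: lim (ltW u0).
Qed.
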